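(* Let $d \ge 2$ and $1 \le k \le d$ be integers. Let $\mathbf{x}, \mathbf{y} \in \mathbb{R}^d$ be nonzero vectors such that $\max\{ \|\mathbf{x}\|_\infty/\|\mathbf{x}\|_2,\ \|\mathbf{y}\|_\infty/\|\mathbf{y}\|_2 \} \le \rho$ for some parameter $\rho < 1$, and let $\theta = \angle(\mathbf{x},\mathbf{y}) \in [0,\pi]$. Let $\Phi$ be the randomized $k$-bit circulant binary embedding defined in the context. Then $$\mathrm{Var}\left[\frac{1}{2k}\,\|\Phi(\mathbf{x}) - \Phi(\mathbf{y})\|_1\right] \le \frac{1}{k}\,\frac{\theta}{\pi}\left(1 - \frac{\theta}{\pi}\right) + 32\rho,$$ where the variance is over the random choice of $\mathbf{r}$ and $\mathbf{D}$.
   Context: For $\mathbf{r} = (r_0,\dots,r_{d-1})^T \in \mathbb{R}^d$, the circulant matrix $\mathrm{circ}(\mathbf{r}) \in \mathbb{R}^{d\times d}$ has $(i,j)$ entry $r_{(i-j) \bmod d}$ (indices $0,\dots,d-1$), i.e. its first column is $\mathbf{r}$ and each subsequent column is the previous one cyclically shifted down by one. The partial circulant matrix $\mathrm{circ}_k(\mathbf{r}) \in \mathbb{R}^{k \times d}$ consists of the first $k$ rows of $\mathrm{circ}(\mathbf{r})$. Randomness: $\mathbf{r}$ has i.i.d. $\mathcal{N}(0,1)$ entries, and $\mathbf{D} = \mathrm{diag}(\sigma_0,\dots,\sigma_{d-1})$ where the $\sigma_i$ are i.i.d. Rademacher signs ($\pm1$ with probability $1/2$ each), independent of $\mathbf{r}$.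 The embedding is $\Phi(\mathbf{z}) = \mathrm{sign}(\mathrm{circ}_k(\mathbf{r})\,\mathbf{D}\,\mathbf{z}) \in \{-1,1\}^k$, with $\mathrm{sign}$ applied entrywise ($\mathrm{sign}(t)=1$ for $t\ge 0$ and $-1$ otherwise). $\angle(\mathbf{x},\mathbf{y})$ denotes the angle $\arccos\big(\langle \mathbf{x},\mathbf{y}\rangle/(\|\mathbf{x}\|_2\|\mathbf{y}\|_2)\big)$. *)

(* Defs.v *)
From HB Require Import structures.
From mathcomp Require Export all_boot all_order all_algebra.
From mathcomp Require Export all_classical all_reals all_analysis.

Set Implicit Arguments.
Unset Strict Implicit.
Unset Printing Implicit Defensive.

Import Order.TTheory GRing.Theory Num.Theory.
Import numFieldNormedType.Exports.

Local Open Scope classical_set_scope.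
Local Open Scope ring_scope.

Section Vectors.
Variables (R : realType) (n : nat).
Implicit Types x y : 'cV[R]_n.

Definition l1norm x : R := \sum_(i < n) `|x i 0|.
Definition l2norm x : R := Num.sqrt (\sum_(i < n) x i 0 ^+ 2).
Definition linfnorm x : R := \big[Num.max/0]_(i < n) `|x i 0|.
Definition dotp x y : R := \sum_(i < n) x i 0 * y i 0.
Definition angle x y : R := acos (dotp x y / (l2norm x * l2norm y)).

End Vectors.

Section CirculantEmbedding.
Variable R : realType.

Lemma ord_mod_subproof (d : nat) (i j : 'I_d) : ((i + (d - j)) %% d < d)%N.
Proof. by rewrite ltn_pmod// (leq_ltn_trans _ (ltn_ord i)). Qed.

(* (i - j) mod d; adding d before subtracting avoids truncation in nat. *)
Definition ord_mod_sub (d : nat) (i j : 'I_d) : 'I_d :=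
  Ordinal (ord_mod_subproof i j).

Definition circ (d : nat) (r : 'cV[R]_d) : 'M[R]_d :=
  \matrix_(i < d, j < d) r (ord_mod_sub i j) 0.

Definition partial_circ (d k : nat) (le_kd : (k <= d)%N) (r : 'cV[R]_d) :
    'M[R]_(k, d) :=
  rowsub (widen_ord le_kd) (circ r).

(* Unlike Num.sg, takes the value 1 at 0. *)
Definition sign (t : R) : R := if 0 <= t then 1 else -1.

Definition circ_embedding (d k : nat) (le_kd : (k <= d)%N)
    (r sigma z : 'cV[R]_d) : 'cV[R]_k :=
  map_mx sign (partial_circ le_kd r *m diag_mx sigma^T *m z).

End CirculantEmbedding.

Section Probability.
Context (disp : measure_display) (T : measurableType disp) (R : realType).
Variable P : probability T R.

Definition mutually_independent (I : finType) (X : I -> {RV P >-> R}) : Prop :=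
  forall (J : {set I}) (A : I -> set R),
    (forall i, measurable (A i)) ->
    P (\bigcap_(i in [set` J]) (X i @^-1` A i)) =
    (\prod_(i in J) P (X i @^-1` A i))%E.

(* Laws are compared on measurable sets only: outside the sigma-algebra the
   values of a measure are unspecified. *)
Definition standard_normal (X : {RV P >-> R}) : Prop :=
  forall A : set R, measurable A -> distribution P X A = normal_prob 0 1 A.

Definition rademacher (X : {RV P >-> R}) : Prop :=
  distribution P X [set 1] = (2^-1)%:E /\
  distribution P X [set -1] = (2^-1)%:E.

Definition sum_family (I J : Type) (X : I -> {RV P >-> R})
    (Y : J -> {RV P >-> R}) (s : I + J) : {RV P >-> R} :=
  match s with inl i => X i | inr j => Y j end.

Definition random_vector (n : nat) (X : 'I_n -> {RV P >-> R}) (w : T) :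
    'cV[R]_n :=
  \col_(i < n) X i w.

End Probability.

(* Main.v *)
Require Import Defs.
From mathcomp Require Import measurable_realfun ring lra.
Set Implicit Arguments.
Unset Strict Implicit.
Unset Printing Implicit Defensive.
Import Order.TTheory GRing.Theory Num.Theory.
Import numFieldNormedType.Exports.
Local Open Scope classical_set_scope.
Local Open Scope ring_scope.

(** Up to the random diagonal signs, the i-th bits of the embeddings of [x] and
    [y] disagree when the Gaussian vector [Z] obtained by reading row [i] of the
    circulant matrix, signs included, has scalar products of different signs with
    [x] and [y]. By rotation invariance of the Gaussian law this has probability
    [theta / pi], whatever the signs. For a second row [j] the event concerns the
    same [Z] and two vectors [a], [b], which are signed cyclic shifts of [x] and
    [y]. Removing from [a] and [b] their components in a plane containing [x] and
    [y] makes the two events independent, and changes the second one with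
    probability at most a constant times the relative size [eps] of the removed
    components. The second moment of [eps] over the random signs is at most
    [4 rho ^ 2], because the entries of [x] and [y] are small, so the mean of each
    covariance is at most [16 rho]. *)

(** Two rows of the circulant matrix hold the same Gaussian variables in different orders, so near
    independence can only come from the geometry of the vectors they are applied to; without the
    signs, a cyclic shift of [x] might stay close to the plane of [x] and [y]. Freezing the signs
    costs nothing in the variance: given a sign pattern, each bit disagrees with probability exactly
    [theta / pi], so the covariance of two bits is the plain average of the conditional covariances.
    The constant 16 arises as follows. Projecting [a] and [b] changes the second event with
    probability at most [2 * eps] for each vector; this is paid once before and once after the
    independent events are factored, and the mean of each [eps] is at most [2 * rho], whence 2 * 2 *
    (2 rho + 2 rho). Gaussian vectors are handled through the probabilities of boxes, without a
    density on the whole space. Hence every orthogonal map in use is composed of rotations in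
    coordinate planes and signed permutations, and rotation invariance has to be computed for the
    planar law only. *)

(** * Rotation invariance of the planar Gaussian law *)

Section AffineSubstitution.
Local Open Scope ereal_scope.
Context {R : realType}.
Local Notation mu := (@lebesgue_measure R).
Implicit Types (a b : R) (f : R -> \bar R).

Lemma affine_measurable a b :
  measurable_fun [set: measurableTypeR R]
    (fun x => a * x + b : measurableTypeR R)%R.
Proof. by apply: measurable_funD => //; exact: measurable_funM. Qed.

(** By uniqueness of Lebesgue measure it is enough to test half-open intervals. A negative slope
    exchanges the open and the closed end, which leaves the length unchanged. *)
Lemma lebesgue_measure_affine a b (A : set (measurableTypeR R)) :
  (a != 0)%R -> measurable A ->
  `|a|%:E * mu ((fun x => a * x + b : measurableTypeR R)%R @^-1` A) = mu A.
Proof.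
move=> a0 mA.
have na : (0 <= `|a|)%R by [].
pose phi x : measurableTypeR R := (a * x + b)%R.
have mphi : measurable_fun setT (phi : measurableTypeR R -> measurableTypeR R).
  exact: affine_measurable.
have := @lebesgue_measure_unique R (mscale (NngNum na) (pushforward mu phi)).
move=> /(_ mphi) muE; apply/esym; rewrite {}[LHS]muE// => _ [[p q]] _ <-.
rewrite /= /mscale /pushforward /=. set B := (X in _ * mu X).
have [a_gt0|a_lt0] : (0 < a \/ a < 0)%R by case: (ltgtP a 0%R) a0; [right|left|].
- have -> : B = [set` `](p - b) / a, (q - b) / a]%R]%R.
    apply/seteqP; split => x /=; rewrite !in_itv/= /phi.
      by rewrite ltr_pdivrMr// ler_pdivlMr// (mulrC x) ltrBlDr lerBrDr.
    by rewrite ltr_pdivrMr// ler_pdivlMr// (mulrC x) ltrBlDr lerBrDr.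
  rewrite !lebesgue_measure_itv/= !lte_fin gtr0_norm// ltr_pM2r ?invr_gt0//.
  rewrite ltrD2r; case: ifP => _; last by rewrite mule0.
  by rewrite -!EFinB -EFinM; congr EFin; field.
- have -> : B = [set` `[(q - b) / a, (p - b) / a[%R]%R.
    apply/seteqP; split => x /=; rewrite !in_itv/= /phi.
      by rewrite ltr_ndivlMr// ler_ndivrMr// (mulrC x) ltrBlDr lerBrDr andbC.
    by rewrite ltr_ndivlMr// ler_ndivrMr// (mulrC x) ltrBlDr lerBrDr andbC.
  rewrite !lebesgue_measure_itv/= !lte_fin ltr0_norm// ltr_nM2r ?invr_lt0//.
  rewrite ltrD2r; case: ifP => _; last by rewrite mule0.
  by rewrite -!EFinB -EFinM; congr EFin; field.
Qed.

Lemma ge0_integral_affine a b f : (a != 0)%R ->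
  measurable_fun [set: measurableTypeR R] f -> (forall x, 0 <= f x) ->
  `|a|%:E * \int[mu]_x f (a * x + b)%R = \int[mu]_x f x.
Proof.
move=> a0 mf f0.
pose phi x : measurableTypeR R := (a * x + b)%R.
have mphi : measurable_fun setT (phi : measurableTypeR R -> measurableTypeR R).
  exact: affine_measurable.
have na : (0 <= `|a|)%R by [].
have -> : \int[mu]_x f (a * x + b)%R = \int[pushforward mu phi]_x f x.
  by rewrite ge0_integral_pushforward.
have := @ge0_integral_mscale _ _ _ (pushforward mu phi) setT measurableT
  (NngNum na) f mf (fun x _ => f0 x).
move=> /(_ mphi)/= <-.
apply: eq_measure_integral => A mA _.
rewrite /= /mscale /pushforward /=. exact: lebesgue_measure_affine.
Qed.

End AffineSubstitution.

Section PlaneRotation.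
Local Open Scope ereal_scope.
Context {R : realType}.
Local Notation TR := (measurableTypeR R).
Local Notation mu := (@lebesgue_measure R).
Local Notation gamma := (@normal_prob R 0 1).
Local Notation phi := (@normal_pdf R 0 1).

Definition rot (c s : R) (z : TR * TR) : TR * TR :=
  (c * z.1 + s * z.2, c * z.2 - s * z.1)%R.

Lemma measurable_rot c s : measurable_fun setT (rot c s).
Proof.
apply: measurable_fun_pair => /=.
  by apply: measurable_funD; apply: measurable_funM.
by apply: measurable_funB; apply: measurable_funM.
Qed.

(** The rotation splits into two affine substitutions in one variable, with Fubini in between: for
    fixed [y], put [u = c * x + s * y]; then for fixed [u] the other coordinate is
    [(y - s * u) / c]. The factors [|c|] and [1 / |c|] cancel. The division is why [c] must be
    nonzero here. *)
Lemma integral_rot c s (psi : TR * TR -> \bar R) :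
  (c != 0)%R -> (c ^+ 2 + s ^+ 2 = 1)%R ->
  measurable_fun setT psi -> (forall z, 0 <= psi z) ->
  \int[mu]_x \int[mu]_y psi (rot c s (x, y)) =
  \int[mu]_x \int[mu]_y psi (x, y).
Proof.
move=> c0 cs1 mpsi psi0.
pose psi1 (z : TR * TR) := psi (z.2, (z.1 - s * z.2) / c)%R.
have mrot : measurable_fun setT (psi \o rot c s).
  by apply: measurableT_comp => //; exact: measurable_rot.
have mpsi1 : measurable_fun setT psi1.
  apply: measurableT_comp => //; apply: measurable_fun_pair => //=.
  by apply: measurable_funM => //; apply: measurable_funB => //;
     apply: measurable_funM.
have sec1 (y : TR) : measurable_fun setT (fun x => psi1 (y, x)).
  by apply: measurableT_comp => //; exact: pair1_measurable.
have sec (x : TR) : measurable_fun setT (fun y => psi (x, y)).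
  by apply: measurableT_comp => //; exact: pair1_measurable.
rewrite (@fubini_tonelli _ _ _ _ _ mu mu (psi \o rot c s))//; last first.
  by move=> z; exact: psi0.
have cV : (`|c|^-1)%:E * `|c|%:E = 1 :> \bar R.
  by rewrite -EFinM mulVf// normr_eq0.
rewrite -[LHS]mul1e -[RHS]mul1e -cV -!muleA; congr (_ * _).
rewrite -ge0_integralZl_EFin//; last 2 first.
  by move=> y _; apply: integral_ge0 => x _; exact: psi0.
  exact: (measurable_fun_fubini_tonelli_G (psi \o rot c s) mrot (fun z => psi0 _)).
rewrite -ge0_integralZl_EFin//; last 2 first.
  by move=> y _; apply: integral_ge0 => x _; exact: psi0.
  exact: (measurable_fun_fubini_tonelli_F psi mpsi psi0).
transitivity (\int[mu]_y \int[mu]_x psi1 (y, x)).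
  apply: eq_integral => y _.
  rewrite -(ge0_integral_affine (s * y) c0 (sec1 y))//; last first.
    by move=> x; exact: psi0.
  congr (_ * _); apply: eq_integral => x _; congr psi; congr pair.
  have : (c * y - s * x = (c ^+ 2 * y + s ^+ 2 * y - s * (c * x + s * y)) / c)%R.
    by field.
  by rewrite -mulrDl cs1 mul1r.
rewrite (@fubini_tonelli _ _ _ _ _ mu mu psi1)//; last first.
  by move=> z; exact: psi0.
apply: eq_integral => x _.
have cV0 : (c^-1 != 0)%R by rewrite invr_eq0.
rewrite -(ge0_integral_affine (- (s * x) / c) cV0 (sec x))//.
rewrite muleA -EFinM normfV mulfV ?normr_eq0// mul1e; apply: eq_integral => y _; congr psi; congr pair => /=.
by field.
Qed.

(** The bound by 1 supplies the integrability required to change variables; the Radon-Nikodym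
    derivative is then identified almost everywhere with the density. *)
Lemma integral_normal_prob (f : TR -> \bar R) : measurable_fun setT f ->
  (forall x, 0 <= f x <= 1) ->
  \int[gamma]_x f x = \int[mu]_x (f x * (phi x)%:E).
Proof.
move=> mf f01.
have intf : gamma.-integrable setT f.
  apply: (@le_integrable _ _ _ _ _ _ _ (EFin \o cst 1%R)) => //; last first.
    exact: finite_measure_integrable_cst.
  by move=> x _; have /andP[f0 f1] := f01 x; rewrite gee0_abs//= normr1.
rewrite -(Radon_Nikodym_change_of_variables (normal_prob_dominates 0 1))//=.
apply: ae_eq_integral => //.
- apply: emeasurable_funM => //; apply: (measurable_int mu).
  by apply: Radon_Nikodym_integrable; exact: normal_prob_dominates.
- apply: emeasurable_funM => //=; apply/measurableT_comp => //=.
  exact: measurable_normal_pdf.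
- apply: ae_eqe_mul2l => /=.
  rewrite Radon_NikodymE//=; first exact: normal_prob_dominates.
  move=> gmu; case: cid => /= h [h1 h2 h3].
  apply: integral_ae_eq => //=.
  + by apply/measurableT_comp =>//; exact: measurable_normal_pdf.
  + by move=> E E01 mE; rewrite -h3//= /normal_prob.
Qed.

Lemma normal_prob2E (S : set (TR * TR)) : measurable S ->
  (gamma \x gamma) S =
  \int[mu]_x \int[mu]_y ((phi x * phi y * \1_S (x, y))%R%:E).
Proof.
move=> mS; rewrite /product_measure1 integral_normal_prob.
- apply: eq_integral => x _; rewrite /= /normal_prob.
  rewrite muleC integral_mkcond -ge0_integralZl_EFin//=.
  + apply: eq_integral => y _; rewrite patchE/= -mulrA EFinM; congr (_ * _).
    rewrite mem_xsection indicE; case: ifPn => _; first by rewrite mulr1.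
    by rewrite mulr0.
  + by move=> y _; rewrite patchE; case: ifP => // _; rewrite lee_fin normal_pdf_ge0.
  + apply/(measurable_restrictT _ (measurable_xsection x mS)).
    apply/measurable_funTS/measurable_EFinP; exact: measurable_normal_pdf.
  + exact: normal_pdf_ge0.
- exact: measurable_fun_xsection.
- by move=> x /=; rewrite measure_ge0 probability_le1//; exact: measurable_xsection.
Qed.
End PlaneRotation.

Section RotationInvariance.
Local Open Scope ereal_scope.
Context {R : realType}.
Local Notation TR := (measurableTypeR R).
Local Notation mu := (@lebesgue_measure R).
Local Notation gamma := (@normal_prob R 0 1).
Local Notation phi := (@normal_pdf R 0 1).

Lemma normal_pdf_rot c s (x y : R) : (c ^+ 2 + s ^+ 2 = 1)%R ->
  (phi (c * x + s * y) * phi (c * y - s * x) = phi x * phi y)%R.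
Proof.
move=> cs1; rewrite normal_pdfE ?oner_neq0//= /normal_fun.
rewrite !(mulrACA _ (expR _)) -!expRD !subr0; congr (_ * expR _)%R.
rewrite -!mulrDl; congr (_ / _)%R; rewrite -!opprD; congr (- _)%R.
transitivity ((c ^+ 2 + s ^+ 2) * (x ^+ 2 + y ^+ 2))%R; first by ring.
by rewrite cs1 mul1r.
Qed.

Lemma normal_prob2_rot c s (S : set (TR * TR)) : (c ^+ 2 + s ^+ 2 = 1)%R ->
  measurable S -> (gamma \x gamma) (rot c s @^-1` S) = (gamma \x gamma) S.
Proof.
have mpre c' s' (S' : set (TR * TR)) : measurable S' ->
    measurable (rot c' s' @^-1` S').
  by move=> mS; rewrite -[X in measurable X]setTI; exact: measurable_rot.
have step c' s' (S' : set (TR * TR)) : (c' != 0)%R ->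
    (c' ^+ 2 + s' ^+ 2 = 1)%R -> measurable S' ->
    (gamma \x gamma) (rot c' s' @^-1` S') = (gamma \x gamma) S'.
  move=> c0 cs1 mS.
  pose psi (z : TR * TR) := (phi z.1 * phi z.2 * \1_S' z)%R%:E.
  apply: (etrans (normal_prob2E (mpre c' s' S' mS))).
  apply: (etrans _ (esym (normal_prob2E mS))).
  apply: (etrans _ (@integral_rot _ c' s' psi c0 cs1 _ _)).
  - apply: eq_integral => x _; apply: eq_integral => y _.
    by rewrite /psi/= normal_pdf_rot.
  - apply/measurable_EFinP; apply: measurable_funM; last exact: measurable_indic.
    by apply: measurable_funM; apply: measurableT_comp => //;
      exact: measurable_normal_pdf.
  - by move=> z; rewrite lee_fin !mulr_ge0// normal_pdf_ge0.
move=> cs1 mS; have [c0|c0] := eqVneq c 0%R; last exact: step.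
(* A quarter turn is two successive eighth turns. *)
pose h : R := (Num.sqrt 2)^-1%R.
have h0 : (h != 0)%R by rewrite invr_eq0 sqrtr_eq0 -ltNge.
have hh : (h ^+ 2 = 2^-1)%R by rewrite exprVn sqr_sqrtr.
have s2 : (s ^+ 2 = 1)%R by rewrite -cs1 c0 expr0n add0r.
have hs1 : (h ^+ 2 + (s * h) ^+ 2 = 1)%R by rewrite exprMn s2 hh; lra.
have rot2 z : rot c s z = rot h (s * h)%R (rot h (s * h)%R z).
  case: z => x y; rewrite /rot/= c0; congr pair.
    transitivity (h ^+ 2 * (x + 2 * s * y - s ^+ 2 * x))%R; last by ring.
    by rewrite hh s2; field.
  transitivity (h ^+ 2 * (y - 2 * s * x - s ^+ 2 * y))%R; last by ring.
  by rewrite hh s2; field.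
have -> : rot c s @^-1` S = rot h (s * h)%R @^-1` (rot h (s * h)%R @^-1` S).
  by apply/seteqP; split=> z; rewrite /preimage/= rot2.
by rewrite (step _ _ _ h0 hs1 (mpre _ _ _ mS)) (step _ _ _ h0 hs1 mS).
Qed.

(** The half turn of the plane, applied to a strip over [A], acts as negation on the first
    coordinate. *)
Lemma normal_probN (A : set TR) : measurable A ->
  gamma ((fun x => - x : TR)%R @^-1` A) = gamma A.
Proof.
move=> mA.
have m1 : measurable ((fun x => - x : TR)%R @^-1` A).
  by rewrite -[X in measurable X]setTI; exact: measurable_funN.
have cs1 : ((-1) ^+ 2 + 0 ^+ 2 = 1 :> R)%R by rewrite sqrrN expr0n expr1n addr0.
have := @normal_prob2_rot (-1)%R 0%R (A `*` setT) cs1 (measurableX mA measurableT).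
rewrite (_ : rot _ _ @^-1` _ = ((fun x => - x : TR)%R @^-1` A) `*` setT).
  have gT (B : set TR) : measurable B -> (gamma \x gamma) (B `*` setT) = gamma B.
    move=> mB; rewrite product_measure1E// -[RHS]mule1; congr (_ * _).
    exact: probability_setT.
  by rewrite !gT.
by apply/seteqP; split => -[x y]/=; rewrite /rot/= mul0r addr0 mulN1r.
Qed.

Lemma normal_prob_set1 (x : R) : gamma [set x : TR] = 0.
Proof.
have := normal_prob_dominates (0%R : R) 1%R.
move=> /null_content_dominatesP; apply => //; exact: lebesgue_measure_set1.
Qed.

End RotationInvariance.

(* The defect [q t = p t - t / L] is odd under [t -> L - t] and doubles with [t] on
   the first half of the interval, so any uniform bound on it can be halved. *)
Lemma doubling_reflection_linear (R : realType) (p : R -> R) (L : R) : 0 < L ->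
  (forall t, 0 <= p t <= 1) ->
  (forall t, 0 <= t -> t < L / 2 -> p (2 * t) = 2 * p t) ->
  (forall t, p (L - t) = 1 - p t) ->
  forall t, 0 <= t <= L -> p t = t / L.
Proof.
move=> L0 p01 dbl refl.
pose q t := p t - t / L.
have qrefl t : q (L - t) = - q t.
  by rewrite /q refl; field; rewrite gt_eqF.
have qle n : forall t, 0 <= t <= L -> `|q t| <= 2^-1 ^+ n.
  elim: n => [|n IH].
    move=> t /andP[t0 tL]; rewrite expr0 /q; have /andP[p0 p1] := p01 t.
    have : 0 <= t / L <= 1.
      by rewrite divr_ge0 ?(ltW L0)//= ler_pdivrMr// mul1r.
    by move=> /andP[u0 u1]; rewrite ler_norml; apply/andP; split; lra.
  have small t : 0 <= t -> t < L / 2 -> `|q t| <= 2^-1 ^+ n.+1.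
    move=> t0 tL.
    have -> : q t = 2^-1 * q (2 * t).
      by rewrite /q dbl//; field; rewrite gt_eqF.
    rewrite normrM exprS ger0_norm ?invr_ge0//.
    by rewrite ler_pM2l ?invr_gt0// IH//; apply/andP; split; lra.
  move=> t /andP[t0 tL]; case: (ltgtP t (L / 2)) => tL2.
  - exact: small.
  - by rewrite -[t](subKr L) qrefl normrN; apply: small; lra.
  - have qt : q t = - q t by rewrite -[in LHS](subKr L t) qrefl; congr (- q _); lra.
    have -> : q t = 0 by lra.
    by rewrite normr0 exprn_ge0// invr_ge0.
move=> t t01; apply/eqP; rewrite -subr_eq0 -/(q t) -normr_le0.
have cvg0 : (2^-1 : R) ^+ n @[n --> \oo] --> (0 : R).
  by apply: cvg_expr; rewrite ger0_norm ?invr_ge0//; lra.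
rewrite -(cvg_lim _ cvg0)//; apply: limr_ge; last by near=> n; exact: qle.
by apply/cvg_ex; exists 0.
Unshelve. all: by end_near. Qed.

(** * The angle law for sign disagreement in the plane *)

Section SignDisagreement.
Context {R : realType}.

Definition sdiff (a b : R) : bool := (0 <= a) != (0 <= b).

Lemma measurable_sdiff d (T : measurableType d) (f g : T -> R) :
  measurable_fun setT f -> measurable_fun setT g ->
  measurable [set w | sdiff (f w) (g w)].
Proof.
move=> mf mg.
have mge (h : T -> R) : measurable_fun setT h -> measurable_fun setT (fun w => 0 <= h w).
  by move=> mh; apply: measurable_fun_ler.
have -> : [set w | sdiff (f w) (g w)] =
  ([set w | 0 <= f w] `&` ~` [set w | 0 <= g w]) `|`
  (~` [set w | 0 <= f w] `&` [set w | 0 <= g w]).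
  apply/seteqP; split=> w /=; rewrite /sdiff.
    by do 2 case: (0 <= _) => //=; [left|right].
  by do 2 case: (0 <= _) => //= -[[]|[]].
have m0 (h : T -> R) : measurable_fun setT h -> measurable [set w | 0 <= h w].
  move=> /mge /(_ measurableT [set true] I); rewrite setTI.
  by congr measurable; apply/seteqP; split => w /=.
by apply: measurableU; apply: measurableI => //; try apply: measurableC; exact: m0.
Qed.

End SignDisagreement.

Section Wedge.
Context {R : realType}.
Local Notation TR := (measurableTypeR R).
Variable Q : probability (TR * TR)%type R.
Hypothesis Qrot : forall c s (S : set (TR * TR)), c ^+ 2 + s ^+ 2 = 1 ->
  measurable S -> Q (rot c s @^-1` S) = Q S.
Hypothesis Q0 : Q ([set 0] `*` setT) = 0%E.

(** Scalar product of [z] with the unit vector of angle [t]. *)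
Definition wave (t : R) (z : TR * TR) : R := cos t * z.1 + sin t * z.2.

Lemma measurable_wave t : measurable_fun setT (wave t).
Proof. by apply: measurable_funD; apply: measurable_funM. Qed.

Let W (a b : R) : set (TR * TR) := [set z | sdiff (wave a z) (wave b z)].

Let mW a b : measurable (W a b).
Proof. by apply: measurable_sdiff; exact: measurable_wave. Qed.

Let p (t : R) : R := fine (Q (W 0 t)).

(** The rotation by [a] brings the directions [a] and [b] to [0] and [b - a], so the probability
    depends on the difference only. *)
Let WE a b : Q (W a b) = (p (b - a))%:E.
Proof.
rewrite /p fineK ?fin_num_measure//.
rewrite -(@Qrot (cos a) (sin a) (W 0 (b - a)))//; last by rewrite cos2Dsin2.
congr (Q _); apply/seteqP.
have wE z : wave 0 (rot (cos a) (sin a) z) = wave a z.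
  by rewrite /wave/= cos0 sin0 mul1r mul0r addr0.
have wE2 z : wave (b - a) (rot (cos a) (sin a) z) = wave b z.
  by rewrite -[b in RHS](subrK a); move: (b - a) => u; rewrite /wave/= cosD sinD; ring.
by split=> z; rewrite /W/= wE wE2.
Qed.

(** Additivity over adjacent wedges gives the doubling relation and [wave pi = - wave 0] the
    reflection. The law thus follows from invariance alone, without integrating a density. *)
Lemma wedge_prob t : 0 <= t <= pi ->
  (Q [set z : TR * TR | sdiff z.1 (wave t z)] = (t / pi)%:E)%E.
Proof.
move=> t0pi.
have -> : [set z : TR * TR | sdiff z.1 (wave t z)] = W 0 t.
  by rewrite /W /wave; apply/seteqP; split=> z/=; rewrite cos0 sin0 mul1r mul0r addr0.
rewrite WE subr0; congr EFin; apply: doubling_reflection_linear => //.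
- exact: pi_gt0.
- move=> s; rewrite /p fine_ge0//= -lee_fin fineK ?fin_num_measure//.
  exact: probability_le1.
(* [wave 0 + wave (2 s)] is a positive multiple of [wave s], so the sign cannot
   change both between [0] and [s] and between [s] and [2 s]. *)
- move=> s s0 spi.
  have cs : 0 < cos s.
    apply: cos_gt0_pihalf; rewrite spi andbT (lt_le_trans _ s0)// oppr_lt0.
    by rewrite divr_gt0// pi_gt0.
  have e z : wave 0 z + wave (2 * s) z = 2 * cos s * wave s z.
    rewrite /wave cos0 sin0 (_ : 2 * s = s + s); last by ring.
    rewrite cosD sinD -/(wave s z).
    transitivity ((1 - (cos s ^+ 2 + sin s ^+ 2)) * z.1 + 2 * cos s * wave s z).
      by rewrite /wave; ring.
    by rewrite cos2Dsin2 subrr mul0r add0r.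
  have ex z : ~~ (sdiff (wave 0 z) (wave s z) && sdiff (wave s z) (wave (2 * s) z)).
    have := e z; rewrite /sdiff.
    by case: lerP => a; case: lerP => b; case: lerP => c //=; nra.
  apply: EFin_inj.
  have -> : 2 * p s = p (s - 0) + p (2 * s - s) :> R.
    by rewrite subr0 (_ : 2 * s - s = s); ring.
  have -> : p (2 * s) = p (2 * s - 0) by rewrite subr0.
  rewrite EFinD -!WE -measureU//.
    congr (Q _); apply/seteqP; split=> z; rewrite /W/= => H; [apply/orP|move/orP: H];
      [move: H|]; move: (ex z); rewrite /sdiff; by do 3 case: (0 <= _).
  rewrite -subset0 => z [] /=; rewrite /W/=; have := ex z; rewrite /sdiff.
  by do 3 case: (0 <= _).
- move=> s.
  have p1 : (1 - p s)%:E = Q (~` W 0 s).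
    rewrite probability_setC// WE subr0 EFinB//.
  apply: EFin_inj; rewrite p1.
  rewrite -(WE s pi).
  (* [wave 0] and [wave pi] are opposite numbers, so exactly one of them is nonnegative except where
     both vanish; that line is null and is removed from both sides. *)
  pose N : set (TR * TR) := [set 0] `*` setT.
  have mN : measurable N by apply: measurableX.
  have N0 : Q N = 0%E by [].
  have dN (S : set (TR * TR)) : measurable S ->
      Q S = Q (S `\` N).
    move=> mS; rewrite measureD//; last by rewrite ltey_eq fin_num_measure.
    rewrite [X in (_ - X)%E](_ : _ = 0%E) ?sube0//.
    by apply: (subset_measure0 _ _ (@subIsetr _ S N)) => //; exact: measurableI.
  rewrite dN// [RHS]dN; last exact: measurableC.
  congr (Q _); apply/seteqP.
  split=> -[x y]; rewrite /W/= /wave/= /sdiff cos0 sin0 cospi sinpi !mul0r !addr0 mul1r mulN1r;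
   rewrite oppr_ge0 => -[h1 h2]; split => //; case: (ltgtP x 0) h1 h2 => x0 //=.
  + by case: (0 <= _).
  + by case: (0 <= _).
  + by move=> _ [].
  + by case: (0 <= _).
  + by case: (0 <= _).
  + by move=> _ [].
Qed.

End Wedge.

(** * Independence of blocks of coordinates *)

Section SigmaIndependence.
Context (disp : measure_display) (T : measurableType disp) (R : realType).
Variable P : probability T R.

(** For fixed [B], both sides are finite measures in [A] that agree on a generating class closed
    under intersection. *)
Lemma g_sigma_indep_l (G : set (set T)) (B : set T) :
  G `<=` measurable -> setI_closed G -> G setT -> measurable B ->
  (forall A, G A -> P (A `&` B) = (P A * P B)%E) ->
  forall A, <<s G >> A -> P (A `&` B) = (P A * P B)%E.
Proof.
move=> Gm GI GT mB GB A GA.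
have PB0 : 0 <= fine (P B) by exact: fine_ge0.
have coverT : \bigcup_(_ : nat) [set: T] = setT by apply: bigcup_const; exists 0%N.
have := @g_sigma_algebra_measure_unique _ _ _ G Gm (fun=> setT) (fun=> GT)
  coverT (mrestr P mB) (mscale (NngNum PB0) P) GI.
move=> /(_ _ _ A GA); rewrite /= /mrestr /mscale/= => ->.
- by rewrite fineK ?fin_num_measure// muleC.
- by move=> C GC; rewrite GB// fineK ?fin_num_measure// muleC.
- by move=> _; rewrite setTI ltey_eq fin_num_measure.
Qed.

Lemma g_sigma_indep (G1 G2 : set (set T)) :
  G1 `<=` measurable -> setI_closed G1 -> G1 setT ->
  G2 `<=` measurable -> setI_closed G2 -> G2 setT ->
  (forall A B, G1 A -> G2 B -> P (A `&` B) = (P A * P B)%E) ->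
  forall A B, <<s G1 >> A -> <<s G2 >> B -> P (A `&` B) = (P A * P B)%E.
Proof.
move=> G1m G1I G1T G2m G2I G2T G12 A B G1A G2B.
have mA : measurable A.
  by apply: (smallest_sub _ _ G1A) => //; exact: sigma_algebra_measurable.
rewrite setIC muleC; apply: (g_sigma_indep_l G2m) => // C G2C.
rewrite setIC muleC; apply: (g_sigma_indep_l G1m) => //; first exact: G2m.
by move=> D G1D; exact: G12.
Qed.

End SigmaIndependence.

Lemma measurable_lincomb (d : measure_display) (T : measurableType d)
  (R : realType) (I : finType) (K : pred I) (u : I -> R) (X : I -> T -> R) :
  (forall i, K i -> measurable_fun setT (X i)) ->
  measurable_fun setT (fun w => \sum_(i | K i) u i * X i w).
Proof.
move=> mX; elim: (index_enum I) => [|i s IH].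
  rewrite [F in measurable_fun _ F](_ : _ = cst 0)//.
  by apply/funext => w; rewrite big_nil.
have [Ki|Ki] := boolP (K i).
  rewrite [F in measurable_fun _ F](_ : _ = (fun w => u i * X i w +
    \sum_(j <- s | K j) u j * X j w)).
    by apply: measurable_funD => //; apply: measurable_funM => //; exact: mX.
  by apply/funext => w; rewrite big_cons Ki.
rewrite [F in measurable_fun _ F](_ : _ =
    (fun w => \sum_(j <- s | K j) u j * X j w))//.
by apply/funext => w; rewrite big_cons (negbTE Ki).
Qed.

Section BlockIndependence.
Context (disp : measure_display) (T : measurableType disp) (R : realType).
Variables (P : probability T R) (I : finType) (X : I -> T -> R).
Hypothesis mX : forall i, measurable_fun setT (X i).
Hypothesis indepX : forall A : I -> set R, (forall i, measurable (A i)) ->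
  P (\bigcap_i (X i @^-1` A i)) = (\prod_i P (X i @^-1` A i))%E.

(** The family [A] ranges over all indices, with [setT] outside [K], so that the product formula for
    the whole family applies directly to the intersection of cylinders over two blocks. *)
Definition cylinders (K : pred I) : set (set T) :=
  [set B | exists A : I -> set R, [/\ forall i, measurable (A i),
    forall i, ~~ K i -> A i = setT & B = \bigcap_i (X i @^-1` A i)]].

Let mpre i (A : set R) : measurable A -> measurable (X i @^-1` A).
Proof. by move=> mA; rewrite -[X in measurable X]setTI; exact: mX. Qed.

Lemma cylinders_measurable K : cylinders K `<=` measurable.
Proof.
move=> _ [A [mA _ ->]].
by apply: fin_bigcap_measurable => // i _; exact: mpre.
Qed.

Lemma cylinders_setI K : setI_closed (cylinders K).
Proof.
move=> _ _ [A [mA AK ->]] [B [mB BK ->]]; exists (fun i => A i `&` B i); split.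
- by move=> i; exact: measurableI.
- by move=> i Ki; rewrite AK// BK// setIT.
- by rewrite -bigcapI; apply: eq_bigcapr.
Qed.

Lemma cylinders_setT K : cylinders K setT.
Proof.
by exists (fun=> setT); split => //; rewrite bigcapT.
Qed.

(** On cylinders, at each index one of the two factors is [setT], so the product over all indices
    separates. *)
Lemma block_indep K A B : <<s cylinders K >> A -> <<s cylinders (predC K) >> B ->
  P (A `&` B) = (P A * P B)%E.
Proof.
apply: g_sigma_indep; [exact: cylinders_measurable|exact: cylinders_setI|
  exact: cylinders_setT|exact: cylinders_measurable|exact: cylinders_setI|
  exact: cylinders_setT|].
move=> _ _ [A' [mA AK ->]] [B' [mB BK ->]].
rewrite -bigcapI.
under eq_bigcapr do rewrite -preimage_setI.
rewrite indepX//; last by move=> i; exact: measurableI.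
rewrite !indepX// -big_split/=; apply: eq_bigr => i _.
have [Ki|Ki] := boolP (K i).
  by rewrite BK ?negbK// setIT preimage_setT probability_setT mule1.
by rewrite AK// setTI preimage_setT probability_setT mul1e.
Qed.

Lemma measurable_coordinate (K : pred I) i : K i ->
  measurable_fun (T := g_sigma_algebraType (cylinders K)) setT (X i).
Proof.
move=> Ki _ Y mY; rewrite setTI; apply: sub_sigma_algebra.
exists (fun j => if j == i then Y else setT); split.
- by move=> j; case: ifP.
- by move=> j; case: eqP => // ->; rewrite Ki.
- apply/seteqP; split=> w/=.
    by move=> Yw j _; case: eqP => // ->.
  by move=> /(_ i Logic.I); rewrite eqxx.
Qed.

(** Taking the generated sigma-algebra as the measurable structure on [T] turns this membership into
    ordinary measurability of linear combinations. *)
Lemma sdiff_linear_sigma (K : pred I) (u v : I -> R) :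
  <<s cylinders K >>
    [set w | sdiff (\sum_(i | K i) u i * X i w) (\sum_(i | K i) v i * X i w)].
Proof.
by apply: (@measurable_sdiff _ _ (g_sigma_algebraType (cylinders K)));
  apply: measurable_lincomb => i Ki; exact: measurable_coordinate.
Qed.

End BlockIndependence.

(** * Gaussian vectors and the isometries that preserve them *)

Section GaussianVector.
Context (disp : measure_display) (T : measurableType disp) (R : realType).
Variable P : probability T R.
Variable n : nat.
Local Notation TR := (measurableTypeR R).
Local Notation gamma := (@normal_prob R 0 1).
Implicit Types Z : T -> 'cV[R]_n.

(** Since any [A i] may be [setT], the single formula on boxes contains the standard normal
    marginals and their independence. *)
Definition gaussian_vector Z : Prop :=
  (forall i, measurable_fun setT (fun w => Z w i 0)) /\
  forall A : 'I_n -> set R, (forall i, measurable (A i)) ->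
    P (\bigcap_i (fun w => Z w i 0) @^-1` A i) = (\prod_i gamma (A i))%E.

Lemma gamma_setT : gamma [set: R] = 1%E.
Proof. exact: probability_setT. Qed.

Lemma gaussian_marginal Z i (A : set R) : gaussian_vector Z -> measurable A ->
  P ((fun w => Z w i 0) @^-1` A) = gamma A.
Proof.
move=> [mZ indepZ] mA.
have := indepZ (fun j => if j == i then A else setT).
rewrite (bigD1 i)//= eqxx big1 ?mule1; last first.
  by move=> j /negbTE ->; exact: gamma_setT.
move=> <-; last by move=> j; case: ifP.
congr (P _); apply/seteqP; split=> w /=; first by move=> Aw j _; case: eqP => // ->.
by move=> /(_ i Logic.I); rewrite eqxx.
Qed.

Lemma gaussian_indep Z : gaussian_vector Z ->
  forall A : 'I_n -> set R, (forall i, measurable (A i)) ->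
  P (\bigcap_i (fun w => Z w i 0) @^-1` A i) =
  (\prod_i P ((fun w => Z w i 0%R) @^-1` A i))%E.
Proof.
move=> gZ A mA; rewrite gZ.2//; apply: eq_bigr => i _.
by rewrite (gaussian_marginal i gZ).
Qed.

Lemma gaussian_pair Z a b (S : set (TR * TR)) : gaussian_vector Z -> a != b ->
  measurable S -> P [set w | S (Z w a 0, Z w b 0)] = (gamma \x gamma)%E S.
Proof.
move=> gZ ab mS.
pose Zab w : TR * TR := (Z w a 0, Z w b 0).
have mZab : measurable_fun setT Zab by apply: measurable_fun_pair; exact: gZ.1.
have := @product_measure_unique _ _ TR TR R gamma gamma (pushforward P Zab).
move=> /(_ mZab) /= -> // A B mA mB; rewrite /pushforward.
have := gZ.2 (fun j => if j == a then A else if j == b then B else setT).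
rewrite (bigD1 a)//= eqxx (bigD1 b)/=; last by rewrite eq_sym.
rewrite eq_sym (negbTE ab) eqxx big1 ?mule1; last first.
  by move=> j /andP[/negbTE -> /negbTE ->]; exact: gamma_setT.
move=> <-; last by move=> j; case: ifP => // _; case: ifP.
congr (P _); apply/seteqP; split=> w /=.
  by move=> [Aw Bw] j _; case: eqP => [->//|_]; case: eqP => [->//|].
move=> H; split; first by have := H a Logic.I; rewrite eqxx.
by have := H b Logic.I; rewrite eq_sym (negbTE ab) eqxx.
Qed.

Definition givens (a b : 'I_n) (c s : R) (z : 'cV[R]_n) : 'cV[R]_n :=
  \col_i (if i == a then c * z a 0 + s * z b 0
          else if i == b then c * z b 0 - s * z a 0 else z i 0).

(** The coordinates [a] and [b] are independent of the others, which do not move, and their joint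
    planar law is rotation invariant. *)
Lemma givens_gaussian a b c s Z : a != b -> c ^+ 2 + s ^+ 2 = 1 ->
  gaussian_vector Z -> gaussian_vector (fun w => givens a b c s (Z w)).
Proof.
move=> ab cs1 gZ; have [mZ indepZ] := gZ.
have mlin (d : measure_display) (U : measurableType d) (f g : U -> R) p q :
    measurable_fun setT f -> measurable_fun setT g ->
    measurable_fun setT (fun w => p * f w + q * g w).
  by move=> mf mg; apply: measurable_funD; apply: measurable_funM.
split=> [i|A mA].
  have [->|ia] := eqVneq i a.
    rewrite [F in measurable_fun _ F](_ : _ = fun w => c * Z w a 0 + s * Z w b 0).
      exact: mlin.
    by apply/funext => w; rewrite mxE eqxx.
  have [->|ib] := eqVneq i b.
    rewrite [F in measurable_fun _ F](_ : _ =
        fun w => c * Z w b 0 + (- s) * Z w a 0); first exact: mlin.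
    by apply/funext => w; rewrite mxE eq_sym (negbTE ab) eqxx mulNr.
  rewrite [F in measurable_fun _ F](_ : _ = fun w => Z w i 0)//.
  by apply/funext => w; rewrite mxE (negbTE ia) (negbTE ib).
pose X i w := Z w i 0.
pose E1 := [set w | A a (c * X a w + s * X b w)] `&`
           [set w | A b (c * X b w + (- s) * X a w)].
pose A' i := if (i == a) || (i == b) then setT else A i.
pose E2 := \bigcap_i (X i @^-1` A' i).
have -> : \bigcap_i (fun w => givens a b c s (Z w) i 0) @^-1` A i = E1 `&` E2.
  apply/seteqP; split=> w /=.
    move=> H; split.
      split; first by have := H a Logic.I; rewrite /= mxE eqxx.
      by have := H b Logic.I; rewrite /= mxE eq_sym (negbTE ab) eqxx /X mulNr.
    move=> i _; have := H i Logic.I; rewrite /A' /= mxE.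
    by case: eqP => //= _; case: eqP.
  move=> [[Ha Hb] H] i _; rewrite /= mxE.
  case: eqP => [->//|/eqP ia]; case: eqP => [->|/eqP ib].
    by move: Hb; rewrite /= /X mulNr.
  by have := H i Logic.I; rewrite /A' (negbTE ia) (negbTE ib).
have -> : P (E1 `&` E2) = (P E1 * P E2)%E.
  apply: (@block_indep _ _ _ P _ X mZ (gaussian_indep gZ) (pred2 a b)).
  - have ma : measurable_fun (T := g_sigma_algebraType (cylinders X (pred2 a b)))
        setT (X a) by apply: measurable_coordinate; rewrite /= eqxx.
    have mb : measurable_fun (T := g_sigma_algebraType (cylinders X (pred2 a b)))
        setT (X b) by apply: measurable_coordinate; rewrite /= eqxx orbT.
    apply: (@measurableI _ (g_sigma_algebraType (cylinders X (pred2 a b)))).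
      have := mlin _ _ _ _ c s ma mb measurableT (A a) (mA a).
      by rewrite setTI.
    have := mlin _ _ _ _ c (- s) mb ma measurableT (A b) (mA b).
    by rewrite setTI.
  - apply: sub_sigma_algebra; exists A'; split => //.
      by move=> i; rewrite /A'; case: ifP.
    by move=> i; rewrite /= negbK /A' => ->.
have -> : P E1 = (gamma (A a) * gamma (A b))%E.
  have mAab : measurable ((A a : set TR) `*` (A b : set TR)) by apply: measurableX; exact: mA.
  apply: (etrans _ (@product_measure1E _ _ TR TR R gamma gamma _ _ (mA a) (mA b))).
  apply: (etrans _ (normal_prob2_rot cs1 mAab)).
  have mrot : measurable (rot c s @^-1` ((A a : set TR) `*` (A b : set TR))).
    by rewrite -[X in measurable X]setTI; exact: measurable_rot.
  apply: (etrans _ (gaussian_pair gZ ab mrot)).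
  by congr (P _); apply/seteqP; split=> w /=; rewrite /rot/= /E1/= /X mulNr.
rewrite indepZ; last by move=> i; rewrite /A'; case: ifP.
rewrite [RHS](bigD1 a)//= [in RHS](bigD1 b)/=; last by rewrite eq_sym.
rewrite (bigD1 a)//= (bigD1 b)/=; last by rewrite eq_sym.
rewrite {1 2}/A' !eqxx orbT/= gamma_setT !mul1e muleA; congr (_ * _)%E.
by apply: eq_bigr => i /andP[/negbTE ia /negbTE ib]; rewrite /A' ia ib.
Qed.

(** A box for the new vector is a box for [Z], with factors permuted by the inverse of [f] and
    reflected where the sign is negative. This covers both the signed rows of the circulant matrix
    and plain sign changes. *)
Lemma gaussian_signed_perm Z (f : 'I_n -> 'I_n) (e : 'I_n -> bool) :
  injective f -> gaussian_vector Z ->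
  gaussian_vector (fun w => \col_i ((-1) ^+ e i * Z w (f i) 0)).
Proof.
move=> finj [mZ indepZ]; split=> [i|A mA].
  rewrite [F in measurable_fun _ F](_ : _ =
    (fun w => (-1) ^+ e i * Z w (f i) 0)); first by apply: measurable_funM.
  by apply/funext => w; rewrite mxE.
have [g fK gK] := injF_bij finj.
pose A' j := if e (g j) then (fun x => - x : TR) @^-1` A (g j) else A (g j).
have mA' j : measurable (A' j).
  rewrite /A'; case: ifP => // _.
  by rewrite -[X in measurable X]setTI; exact: measurable_funN.
rewrite (_ : \bigcap_i _ = \bigcap_j (fun w => Z w j 0) @^-1` A' j).
  rewrite indepZ// (reindex f); last by exists g => i _.
  apply: eq_bigr => i _; rewrite /A' fK; case: ifP => // _.
  exact: (normal_probN (mA i)).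
apply/seteqP; split=> w /= H j _; rewrite /= ?mxE.
  have := H (g j) Logic.I; rewrite /= mxE gK /A'.
  by case: (e (g j)) => /=; rewrite ?mulN1r ?mul1r.
have := H (f j) Logic.I; rewrite /= /A' fK.
by case: (e j) => /=; rewrite ?mulN1r ?mul1r.
Qed.

End GaussianVector.

Section DotProduct.
Context {R : realType} {n : nat}.
Implicit Types x y : 'cV[R]_n.

Lemma dotpC x y : dotp x y = dotp y x.
Proof. by apply: eq_bigr => i _; rewrite mulrC. Qed.

Lemma dotp0 x : dotp 0 x = 0.
Proof. by rewrite /dotp big1// => i _; rewrite mxE mul0r. Qed.

Lemma dotpp_ge0 x : 0 <= dotp x x.
Proof. by apply: sumr_ge0 => i _; rewrite -expr2 sqr_ge0. Qed.

Lemma l2normE x : l2norm x = Num.sqrt (dotp x x).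
Proof. by congr Num.sqrt; apply: eq_bigr => i _; rewrite expr2. Qed.

Lemma dotpp_gt0 x : x != 0 -> 0 < dotp x x.
Proof.
move=> x0; rewrite lt_def dotpp_ge0 andbT; apply: contra x0 => /eqP xx0.
apply/eqP/matrixP => i j; rewrite ord1 mxE.
have /eqP := xx0; rewrite psumr_eq0; last by move=> k _; rewrite -expr2 sqr_ge0.
by move=> /allP/(_ i); rewrite mem_index_enum -expr2 sqrf_eq0 => /(_ isT)/eqP.
Qed.

Lemma dotp_delta x i : dotp x (delta_mx i 0) = x i 0.
Proof.
rewrite /dotp (bigD1 i)//= mxE !eqxx mulr1 big1 ?addr0// => j ji.
by rewrite mxE (negbTE ji) mulr0.
Qed.

End DotProduct.

Section GaussianIsometry.
Context (disp : measure_display) (T : measurableType disp) (R : realType).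
Variable P : probability T R.

(** An orthogonal map [f], given with [g], which is at once its adjoint and its inverse.
    Preservation of Gaussian vectors is carried along, since it is established for the generators
    and passes to compositions. *)
Definition gauss_iso n (f g : 'cV[R]_n -> 'cV[R]_n) : Prop :=
  [/\ forall u v, dotp (f u) v = dotp u (g v), cancel f g, cancel g f &
      forall Z, gaussian_vector P Z -> gaussian_vector P (fun w => f (Z w))].

Lemma gauss_iso_comp n (f1 g1 f2 g2 : 'cV[R]_n -> 'cV[R]_n) :
  gauss_iso f1 g1 -> gauss_iso f2 g2 -> gauss_iso (f2 \o f1) (g1 \o g2).
Proof.
move=> [a1 fK1 gK1 G1] [a2 fK2 gK2 G2]; split=> [u v|||Z gZ].
- by rewrite /= a2 a1.
- exact: can_comp.
- exact: can_comp.
- by apply: G2; exact: G1.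
Qed.

Lemma gauss_iso_dotp n (f g : 'cV[R]_n -> 'cV[R]_n) u v :
  gauss_iso f g -> dotp (f u) (f v) = dotp u v.
Proof. by move=> [adj fK _ _]; rewrite adj fK. Qed.

Lemma gauss_iso_givens n (a b : 'I_n) c s : a != b -> c ^+ 2 + s ^+ 2 = 1 ->
  gauss_iso (givens a b c s) (givens a b c (- s)).
Proof.
move=> ab cs1; have ba : (b == a) = false by rewrite eq_sym (negbTE ab).
have K t z : t ^+ 2 = s ^+ 2 -> givens a b c (- t) (givens a b c t z) = z.
  move=> ts; have ct1 : c ^+ 2 + t ^+ 2 = 1 by rewrite ts.
  apply/matrixP => i j; rewrite ord1 !mxE !eqxx ba.
  case: eqP => [->|_].
    by transitivity ((c ^+ 2 + t ^+ 2) * z a 0); [ring|rewrite ct1 mul1r].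
  case: eqP => [->|//].
  by transitivity ((c ^+ 2 + t ^+ 2) * z b 0); [ring|rewrite ct1 mul1r].
split.
- move=> u v; rewrite /dotp (bigD1 a)//= (bigD1 b) ?ba//=.
  rewrite [RHS](bigD1 a)//= [in RHS](bigD1 b) ?ba//= !mxE !eqxx ba !addrA.
  congr (_ + _); first by ring.
  by apply: eq_bigr => i /andP[/negbTE ia /negbTE ib]; rewrite !mxE ia ib.
- by move=> z; exact: K.
- by move=> z; have := K (- s) z; rewrite opprK sqrrN; exact.
- by move=> Z; exact: givens_gaussian.
Qed.

Lemma gauss_iso_flip n (e : 'I_n -> bool) :
  gauss_iso (fun z => \col_i ((-1) ^+ e i * z i 0))
            (fun z => \col_i ((-1) ^+ e i * z i 0)).
Proof.
split=> [u v|z|z|Z gZ].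
- by apply: eq_bigr => i _; rewrite !mxE; ring.
- by apply/matrixP => i j; rewrite ord1 !mxE mulrA -expr2 sqrr_sign mul1r.
- by apply/matrixP => i j; rewrite ord1 !mxE mulrA -expr2 sqrr_sign mul1r.
- exact: gaussian_signed_perm.
Qed.

(** Givens elimination with pivot [m]: the entries beyond the pivot are rotated into it one at a
    time. The clause on fixed vectors lets a later pass, with a larger pivot, keep the zeros made by
    an earlier one. *)
Lemma gauss_iso_eliminate n (m : 'I_n) (u : 'cV[R]_n) (k : nat) : (k <= n)%N ->
  exists f g, [/\ gauss_iso f g,
    forall z : 'cV[R]_n, (forall i : 'I_n, (m <= i)%N -> z i 0 = 0) -> f z = z &
    forall i : 'I_n, (m < i < k)%N -> f u i 0 = 0].
Proof.
elim: k => [_|k IH kn].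
  by exists id, id; split => // i; rewrite ltn0 andbF.
have [f [g [fg fz fu]]] := IH (ltnW kn); pose o := Ordinal kn.
have [fo0|fo0] := eqVneq (f u o 0) 0.
  exists f, g; split => // i /andP[mi]; rewrite ltnS leq_eqVlt => /predU1P[ik|ik].
    by rewrite (_ : i = o)//; exact: val_inj.
  by rewrite fu// mi.
have [km|mk] := leqP k m.
  exists f, g; split => // i /andP[mi]; rewrite ltnS => ik.
  by move: (leq_trans mi (leq_trans ik km)); rewrite ltnn.
pose r := Num.sqrt (f u m 0 ^+ 2 + f u o 0 ^+ 2).
have r2 : r ^+ 2 = f u m 0 ^+ 2 + f u o 0 ^+ 2.
  by rewrite sqr_sqrtr// addr_ge0// sqr_ge0.
have r0 : r != 0.
  rewrite -sqrf_eq0 r2 paddr_eq0 ?sqr_ge0// !sqrf_eq0 negb_and.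
  by rewrite fo0 orbT.
have mo : m != o by rewrite neq_ltn mk.
pose c := f u m 0 / r; pose s := f u o 0 / r.
have cs1 : c ^+ 2 + s ^+ 2 = 1.
  by rewrite /c /s !expr_div_n -mulrDl -r2 divff// sqrf_eq0.
exists (givens m o c s \o f), (g \o givens m o c (- s)); split.
- exact: gauss_iso_comp fg (gauss_iso_givens mo cs1).
- move=> z z0 /=; rewrite fz//; apply/matrixP => i j; rewrite ord1 mxE.
  have zm : z m 0 = 0 by exact: z0.
  have zo : z o 0 = 0 by apply: z0; exact: ltnW.
  case: eqP => [->|_]; first by rewrite zm zo !mulr0 addr0.
  by case: eqP => [->|//]; rewrite zm zo !mulr0 subr0.
- move=> i /andP[mi ik]; rewrite /= mxE; case: eqP => [im|_].
    by move: mi; rewrite im ltnn.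
  case: eqP => [_|io]; first by rewrite /c /s; field.
  apply: fu; rewrite mi/= ltn_neqAle -ltnS ik andbT.
  by apply/eqP => ik'; apply: io; exact: val_inj.
Qed.

Definition ord1S n : 'I_n.+2 := Ordinal (isT : 1 < n.+2)%N.

(** These are the first two columns of a QR factorisation with nonnegative diagonal. The sign of the
    second diagonal entry matters later: it puts the image of [y] in the half plane where [acos]
    recovers its angle. *)
Lemma gauss_iso_planar n (x y : 'cV[R]_n.+2) :
  exists f g, [/\ gauss_iso f g,
    forall i, i != ord0 -> f x i 0 = 0, 0 <= f x ord0 0,
    forall i, i != ord0 -> i != ord1S n -> f y i 0 = 0 & 0 <= f y (ord1S n) 0].
Proof.
have [f1 [g1 [fg1 _ f1x]]] := gauss_iso_eliminate (ord0 : 'I_n.+2) x (leqnn _).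
have [f2 [g2 [fg2 f2z f2y]]] :=
  gauss_iso_eliminate (ord1S n) (f1 y) (leqnn _).
pose f := f2 \o f1.
have fx i : i != ord0 -> f x i 0 = 0.
  move=> i0; have ig : (0 < i)%N by rewrite lt0n.
  rewrite /f/= f2z; first by apply: f1x; rewrite ig/=.
  by move=> j j1; apply: f1x; rewrite (leq_trans _ j1)/=.
have fy i : i != ord0 -> i != ord1S n -> f y i 0 = 0.
  move=> i0 i1; apply: f2y; rewrite ltn_ord andbT.
  by case: i i0 i1 => [[|[|i]] ?].
(* The sign of coordinate 0 is read from the image of [x], the others from the image of [y], so that
   both pivots become nonnegative. *)
pose e (i : 'I_n.+2) := if i == ord0 then f x i 0 < 0 else f y i 0 < 0.
have flip_ge0 (a : R) : 0 <= (-1) ^+ (a < 0)%R * a.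
  by case: ltrP => a0; rewrite ?expr1 ?mulN1r ?expr0 ?mul1r// oppr_ge0 ltW.
exists ((fun z : 'cV_n.+2 => \col_i ((-1) ^+ e i * z i 0)) \o f).
exists ((g1 \o g2) \o (fun z : 'cV_n.+2 => \col_i ((-1) ^+ e i * z i 0))); split.
- apply: gauss_iso_comp (gauss_iso_flip e); exact: gauss_iso_comp.
- by move=> i i0; rewrite /= mxE fx// mulr0.
- by rewrite /= mxE /e eqxx; exact: flip_ge0.
- by move=> i i0 i1; rewrite /= mxE fy// mulr0.
- by rewrite /= mxE /e; exact: flip_ge0.
Qed.

End GaussianIsometry.

Lemma sdiff_scale (R : realType) (k l a b : R) : 0 < k -> 0 < l ->
  sdiff (k * a) (l * b) = sdiff a b.
Proof. by move=> k0 l0; rewrite /sdiff !pmulr_rge0. Qed.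

(** * The angle law in arbitrary dimension *)

Section SignDisagreementProbability.
Context (disp : measure_display) (T : measurableType disp) (R : realType).
Variables (P : probability T R) (n : nat).
Local Notation TR := (measurableTypeR R).
Local Notation gamma := (@normal_prob R 0 1).

Lemma gaussian_wedge (Z : T -> 'cV[R]_n.+2) t : gaussian_vector P Z ->
  0 <= t <= pi ->
  P [set w | sdiff (Z w ord0 0) (cos t * Z w ord0 0 + sin t * Z w (ord1S n) 0)] =
  (t / pi)%:E.
Proof.
move=> gZ t0pi.
have mS : measurable [set z : TR * TR | sdiff z.1 (wave t z)].
  by apply: measurable_sdiff => //; exact: measurable_wave.
apply: (etrans (gaussian_pair gZ (isT : ord0 != ord1S n) mS)).
have Q0 : (gamma \x gamma)%E ([set (0 : TR)] `*` [set: TR]) = 0%E.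
  apply: (etrans (product_measure1E _ _ _ _)) => //.
  by apply: (etrans _ (mul0e (gamma setT))); congr (_ * _)%E; exact: normal_prob_set1.
exact: (@wedge_prob R (gamma \x gamma)%E (@normal_prob2_rot R) Q0 t t0pi).
Qed.

(** An isometry sends [u] to [(alpha, 0)] and [v] to [(beta, beta')] in the first coordinate plane.
    Dividing by the positive norms changes no sign and leaves the directions [0] and [t] of the
    planar wedge. *)
Lemma gaussian_sdiff_angle (Z : T -> 'cV[R]_n.+2) u v : gaussian_vector P Z ->
  u != 0 -> v != 0 ->
  P [set w | sdiff (dotp (Z w) u) (dotp (Z w) v)] = (angle u v / pi)%:E.
Proof.
move=> gZ u0 v0.
have [f [g [fg fu fu0 fv fv0]]] := gauss_iso_planar P u v.
pose alpha := f u ord0 0; pose beta := f v ord0 0; pose beta' := f v (ord1S n) 0.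
have dotu z : dotp z (f u) = z ord0 0 * alpha.
  by rewrite /dotp (bigD1 ord0)//= big1 ?addr0// => i i0; rewrite fu// mulr0.
have dotv z : dotp z (f v) = z ord0 0 * beta + z (ord1S n) 0 * beta'.
  rewrite /dotp (bigD1 ord0)//= (bigD1 (ord1S n))//= big1 ?addr0//.
  by move=> i /andP[i0 i1]; rewrite fv// mulr0.
have uu : dotp u u = alpha ^+ 2 by rewrite -(gauss_iso_dotp u u fg) dotu expr2.
have vv : dotp v v = beta ^+ 2 + beta' ^+ 2.
  by rewrite -(gauss_iso_dotp v v fg) dotv !expr2.
have uv : dotp u v = alpha * beta.
  by rewrite -(gauss_iso_dotp u v fg) dotpC dotu mulrC.
have a0 : 0 < alpha.
  rewrite lt_def fu0 andbT; have := dotpp_gt0 u0; rewrite uu.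
  by rewrite exprn_even_gt0.
pose r := l2norm v.
have r0 : 0 < r by rewrite /r l2normE sqrtr_gt0; exact: dotpp_gt0.
have r2 : r ^+ 2 = beta ^+ 2 + beta' ^+ 2.
  by rewrite /r l2normE sqr_sqrtr ?dotpp_ge0.
have -> : angle u v = acos (beta / r).
  rewrite /angle (_ : l2norm u = alpha); last first.
    by rewrite l2normE uu sqrtr_sqr gtr0_norm.
  by rewrite uv -/r; congr acos; field; rewrite !gt_eqF.
have br : -1 <= beta / r <= 1.
  rewrite -ler_norml normrM normfV (gtr0_norm r0) ler_pdivrMr// mul1r.
  rewrite -[leRHS]gtr0_norm// -ler_sqr ?nnegrE// !real_normK ?num_real//.
  by rewrite r2 lerDl sqr_ge0.
set t := acos _.
have ct : cos t = beta / r by rewrite acosK.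
have st : sin t = beta' / r.
  rewrite /t sin_acos// (_ : 1 - _ = (beta' / r) ^+ 2).
    by rewrite sqrtr_sqr ger0_norm// divr_ge0// ltW.
  rewrite !expr_div_n r2; field.
  by rewrite -r2 sqrf_eq0 gt_eqF.
have Gt := gaussian_wedge (t := t) (let: And4 _ _ _ h := fg in h _ gZ).
rewrite -Gt; last by rewrite acos_ge0//= acos_lepi.
congr (P _); apply/seteqP.
have E w : sdiff (dotp (Z w) u) (dotp (Z w) v) =
  sdiff (f (Z w) ord0 0)
        (cos t * f (Z w) ord0 0 + sin t * f (Z w) (ord1S n) 0).
  rewrite -(gauss_iso_dotp (Z w) u fg) -(gauss_iso_dotp (Z w) v fg).
  rewrite dotu dotv mulrC -[RHS](sdiff_scale _ _ a0 r0); congr sdiff.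
  by rewrite ct st; field; rewrite gt_eqF.
by split=> w/=; rewrite E.
Qed.

End SignDisagreementProbability.

(** The root [e] is the sine of the angle [t]. If [e] is at least 1/2, the bound [t <= pi] is
    enough. Otherwise [k] is at least 1/2, and the mean value theorem for [sin] gives
    [e = cos c * t] with [cos c >= k]. *)
Lemma acos_le_sqrt (R : realType) (k : R) : 0 <= k <= 1 ->
  acos k <= 2 * pi * Num.sqrt (1 - k ^+ 2).
Proof.
move=> /andP[k0 k1]; set e := Num.sqrt _.
have k11 : -1 <= k <= 1 by rewrite k1 andbT; lra.
have pi0 := pi_gt0 R.
have [e2|e2] := lerP (2^-1) e.
  apply: (le_trans (acos_lepi k11)).
  have : pi * (2 * 2^-1) <= pi * (2 * e) by rewrite ler_pM2l// ler_pM2l.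
  by lra.
have ee : e ^+ 2 = 1 - k ^+ 2.
  by rewrite sqr_sqrtr// subr_ge0 expr_le1.
have e0 : 0 <= e by exact: sqrtr_ge0.
have k2 : 2^-1 <= k by nra.
set t := acos k.
have t0 : 0 <= t by exact: acos_ge0.
have se : sin t = e by rewrite sin_acos.
have tk : cos t = k by rewrite acosK.
have tpi : t <= pi by exact: acos_lepi.
have [c ctin] : exists2 c, c \in `[0, t] & sin t - sin 0 = cos c * (t - 0).
  apply: (@MVT_segment _ sin cos) => //.
  by apply: continuous_subspaceT => x; exact: continuous_sin.
rewrite sin0 !subr0 se => ->.
move: ctin; rewrite in_itv/= => /andP[c0 ct].
have kc : k <= cos c.
  rewrite -tk leNgt; apply/negP; rewrite ltr_cos ?in_itv/= ?t0 ?c0 ?(le_trans ct)//.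
  by rewrite ltNge ct.
have pi2 := pi_ge2 R.
have pc : 1 <= 2 * pi * cos c by nra.
by rewrite mulrA ler_peMl.
Qed.

(** * Near independence of two sign disagreements *)

Section RealProbability.
Context (disp : measure_display) (T : measurableType disp) (R : realType).
Variable P : probability T R.
Implicit Types A B : set T.

Definition pr A : R := fine (P A).

Lemma prE A : measurable A -> P A = (pr A)%:E.
Proof. by move=> mA; rewrite /pr fineK// fin_num_measure. Qed.

Lemma pr_ge0 A : 0 <= pr A.
Proof. exact: fine_ge0. Qed.

Lemma pr_le1 A : measurable A -> pr A <= 1.
Proof. by move=> mA; rewrite -lee_fin -prE// probability_le1. Qed.

Lemma pr_le A B : measurable A -> measurable B -> A `<=` B -> pr A <= pr B.
Proof. by move=> mA mB AB; rewrite -lee_fin -!prE// le_measure ?inE. Qed.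

Lemma prU_le A B : measurable A -> measurable B -> pr (A `|` B) <= pr A + pr B.
Proof.
move=> mA mB; rewrite -lee_fin EFinD -!prE//; last exact: measurableU.
exact: measureU2.
Qed.

End RealProbability.

Section NearIndependence.
Context (disp : measure_display) (T : measurableType disp) (R : realType).
Variables (P : probability T R) (n : nat).
Implicit Types (Z : T -> 'cV[R]_n.+2) (u v a b : 'cV[R]_n.+2).

Definition sdiff_event Z u v : set T :=
  [set w | sdiff (dotp (Z w) u) (dotp (Z w) v)].

Lemma measurable_dotp Z u : gaussian_vector P Z ->
  measurable_fun setT (fun w => dotp (Z w) u).
Proof.
move=> [mZ _].
rewrite [F in measurable_fun _ F](_ : _ = (fun w => \sum_i u i 0 * Z w i 0)).
  exact: measurable_lincomb.
by apply/funext => w; apply: eq_bigr => i _; rewrite mulrC.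
Qed.

Lemma measurable_sdiff_event Z u v : gaussian_vector P Z ->
  measurable (sdiff_event Z u v).
Proof. by move=> gZ; apply: measurable_sdiff; exact: measurable_dotp. Qed.

(** The condition on [v] says that [u - v] is orthogonal to [v]. The cosine of the angle is then the
    ratio of the norms, and its sine, the root in the bound, is the relative size of the removed
    component. For [v = 0] the bound equals 2. *)
Lemma gaussian_sdiff_proj Z u v : gaussian_vector P Z -> u != 0 ->
  dotp u v = dotp v v ->
  pr P (sdiff_event Z u v) <= 2 * Num.sqrt (1 - dotp v v / dotp u u).
Proof.
move=> gZ u0 uv; have uu := dotpp_gt0 u0.
have [->|v0] := eqVneq v 0.
  rewrite dotp0 mul0r subr0 sqrtr1 mulr1.
  by rewrite (le_trans (pr_le1 _ (measurable_sdiff_event _ _ gZ)))// ler1n.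
have vv := dotpp_gt0 v0.
have vu : dotp v v <= dotp u u.
  rewrite -subr_ge0; have := dotpp_ge0 (u - v); congr (_ <= _).
  transitivity (dotp u u - dotp u v *+ 2 + dotp v v); last by rewrite uv; ring.
  rewrite /dotp -sumrMnl -sumrN -!big_split/=; apply: eq_bigr => i _.
  by rewrite !mxE; ring.
rewrite /pr (gaussian_sdiff_angle gZ)//=.
rewrite ler_pdivrMr ?pi_gt0// -mulrA [X in _ * X]mulrC mulrA.
pose k := l2norm v / l2norm u.
have k2 : k ^+ 2 = dotp v v / dotp u u.
  by rewrite expr_div_n !l2normE !sqr_sqrtr ?dotpp_ge0.
have nu : 0 < l2norm u by rewrite l2normE sqrtr_gt0.
have nv : 0 < l2norm v by rewrite l2normE sqrtr_gt0.
have k0 : 0 <= k by rewrite divr_ge0// ltW.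
have -> : angle u v = acos k.
  rewrite /angle uv /k; congr acos.
  have -> : dotp v v = l2norm v ^+ 2 by rewrite l2normE sqr_sqrtr// ltW.
  by field; rewrite !gt_eqF.
rewrite -k2; apply: acos_le_sqrt; rewrite k0/=.
by rewrite -(@expr_le1 _ 2)// k2 ler_pdivrMr// mul1r.
Qed.

(* [q0] and [q1] span a plane containing [x] and [y]. *)
Lemma sdiff_event_near_indep (x y : 'cV[R]_n.+2) :
  exists q0 q1, [/\ dotp q0 q0 = 1, dotp q1 q1 = 1 &
    forall Z a b, gaussian_vector P Z -> a != 0 -> b != 0 ->
    pr P (sdiff_event Z x y `&` sdiff_event Z a b) <=
    pr P (sdiff_event Z x y) * pr P (sdiff_event Z a b) +
    4 * (Num.sqrt ((dotp a q0 ^+ 2 + dotp a q1 ^+ 2) / dotp a a) +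
         Num.sqrt ((dotp b q0 ^+ 2 + dotp b q1 ^+ 2) / dotp b b))].
Proof.
have [f [g [fg fx _ fy _]]] := gauss_iso_planar P x y.
have [adj fK gK fgauss] := fg.
pose q i := g (delta_mx i 0).
have qq i : dotp (q i) (q i) = 1.
  rewrite -(gauss_iso_dotp _ _ fg) gK dotp_delta mxE !eqxx//.
exists (q ord0), (q (ord1S n)); split => // Z a b gZ a0 b0.
have qE c i : dotp c (q i) = f c i 0 by rewrite /q -adj dotp_delta.
rewrite !qE.
pose K := pred2 (ord0 : 'I_n.+2) (ord1S n).
pose X i w := f (Z w) i 0.
pose Z1 w := f (Z w).
have gZ1 : gaussian_vector P Z1 by exact: fgauss.
have fE u v : sdiff_event Z u v = sdiff_event Z1 (f u) (f v).
  by apply/seteqP; split=> w; rewrite /sdiff_event/= !(gauss_iso_dotp _ _ fg).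
(* In rotated coordinates, the component orthogonal to the plane: it involves only the coordinates
   outside [K], whereas [x] and [y] involve only those in [K]. *)
pose tail c : 'cV[R]_n.+2 := \col_i (if K i then 0 else f c i 0).
have tailE c z : dotp z (tail c) = \sum_(i | predC K i) f c i 0 * z i 0.
  rewrite /dotp [RHS]big_mkcond; apply: eq_bigr => i _; rewrite mxE.
  by rewrite -[predC K i]/(~~ K i); case: (K i); rewrite ?mulr0// mulrC.
have tail2 c : c != 0 -> 1 - dotp (tail c) (tail c) / dotp (f c) (f c) =
    (f c ord0 0 ^+ 2 + f c (ord1S n) 0 ^+ 2) / dotp (f c) (f c).
  move=> c0.
  have cc : dotp (f c) (f c) != 0.
    by rewrite (gauss_iso_dotp _ _ fg) gt_eqF// dotpp_gt0.
  rewrite -{1}(divff cc) -mulrBl; congr (_ / _).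
  have -> : dotp (f c) (f c) =
      f c ord0 0 ^+ 2 + f c (ord1S n) 0 ^+ 2 + dotp (tail c) (tail c).
    rewrite /dotp (bigD1 ord0)//= (bigD1 (ord1S n))//=.
    rewrite [in RHS](bigD1 ord0)//= [in RHS](bigD1 (ord1S n))//=.
    rewrite !mxE /K/= !mulr0 !add0r addrA !expr2; congr (_ + _).
    by apply: eq_bigr => i /andP[/negbTE i0 /negbTE i1]; rewrite mxE /= i0 i1.
  by rewrite addrK.
have tailP c : c != 0 -> pr P (sdiff_event Z1 (f c) (tail c)) <=
    2 * Num.sqrt ((f c ord0 0 ^+ 2 + f c (ord1S n) 0 ^+ 2) / dotp c c).
  move=> c0; rewrite -(gauss_iso_dotp c c fg) -tail2//; apply: gaussian_sdiff_proj => //.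
    apply: contraTneq (dotpp_gt0 c0) => fc0.
    by rewrite -(gauss_iso_dotp c c fg) fc0 dotp0 ltxx.
  by rewrite !tailE; apply: eq_bigr => i /negbTE Ki; rewrite mxE Ki.
set E1 := sdiff_event Z x y; set E2 := sdiff_event Z a b.
pose E' := sdiff_event Z1 (tail a) (tail b).
pose Da := sdiff_event Z1 (f a) (tail a).
pose Db := sdiff_event Z1 (f b) (tail b).
have mE1 : measurable E1 by exact: measurable_sdiff_event.
have mE2 : measurable E2 by exact: measurable_sdiff_event.
have mE' : measurable E' by exact: measurable_sdiff_event.
have mDa : measurable Da by exact: measurable_sdiff_event.
have mDb : measurable Db by exact: measurable_sdiff_event.
have mD : measurable (Da `|` Db) by exact: measurableU.
have indep : pr P (E1 `&` E') = pr P E1 * pr P E'.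
  apply: EFin_inj; rewrite EFinM -!prE//; last exact: measurableI.
  apply: (@block_indep _ _ _ P _ X gZ1.1 (gaussian_indep gZ1) K).
    have := @sdiff_linear_sigma _ T R _ X K (fun i => f x i 0) (fun i => f y i 0).
    congr (<<s _ >> _); apply/seteqP.
    have KE u : (forall i, ~~ K i -> f u i 0 = 0) ->
        forall w, \sum_(i | K i) f u i 0 * X i w = dotp (Z w) u.
      move=> fu w; rewrite -(gauss_iso_dotp _ _ fg) big_mkcond.
      apply: eq_bigr => i _; rewrite mulrC; case: ifPn => // Ki.
      by rewrite fu// mulr0.
    have Kx i : ~~ K i -> f x i 0 = 0.
      by rewrite /K/= negb_or => /andP[i0 _]; exact: fx.
    have Ky i : ~~ K i -> f y i 0 = 0.
      by rewrite /K/= negb_or => /andP[i0 i1]; exact: fy.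
    by split=> w; rewrite /E1 /sdiff_event/= !KE.
  have := @sdiff_linear_sigma _ T R _ X (predC K) (fun i => f a i 0) (fun i => f b i 0).
  by congr (<<s _ >> _); apply/seteqP; split=> w; rewrite /E' /sdiff_event/= !tailE.
(* Outside [Da] and [Db] the truncation changes no sign, so [E2] and [E'] agree there. The exchange
   is made here and undone in [le2], which doubles the factor 2 of [tailP] into 4. *)
have le1 : pr P (E1 `&` E2) <= pr P (E1 `&` E') + pr P (Da `|` Db).
  apply: (le_trans _ (prU_le P (measurableI _ _ mE1 mE') mD)).
  apply: pr_le.
  - exact: measurableI.
  - by apply: measurableU => //; exact: measurableI.
  - move=> w [H1]; rewrite /E2 fE /sdiff_event/=.
    case: (boolP (sdiff (dotp (Z1 w) (tail a)) (dotp (Z1 w) (tail b)))) => H2.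
      by left; split.
    move=> H3; right; apply/orP; move: H2 H3; rewrite /sdiff.
    by do 4 case: (0 <= _).
have le2 : pr P E' <= pr P E2 + pr P (Da `|` Db).
  apply: (le_trans _ (prU_le P mE2 mD)).
  apply: pr_le => //; first exact: measurableU.
  move=> w H1; rewrite /E2 fE /sdiff_event/=.
  case: (boolP (sdiff (dotp (Z1 w) (f a)) (dotp (Z1 w) (f b)))) => H2.
    by left.
  right; apply/orP; move: H2 H1; rewrite /E' /sdiff_event/= /sdiff.
  by do 4 case: (0 <= _).
have le3 := prU_le P mDa mDb.
have := tailP _ a0; have := tailP _ b0; rewrite -/Da -/Db.
have := pr_le1 P mE1; have := pr_ge0 P E1; rewrite indep in le1.
have := pr_ge0 P (Da `|` Db).
set A := Num.sqrt _; set B := Num.sqrt _.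
move=> D0 E0 E11 hb ha.
have : pr P E1 * pr P E' <= pr P E1 * (pr P E2 + pr P (Da `|` Db)).
  by rewrite ler_wpM2l.
nra.
Qed.

End NearIndependence.

(** * Averages over the sign patterns *)

Section SignAverages.
Context {R : realType} {n : nat}.
Local Notation signs := {ffun 'I_n -> bool}.
Implicit Types (s : signs) (c : 'I_n -> R).

Local Notation eps s i := ((-1 : R) ^+ s i).

Lemma card_signs : #|{: signs}| = (2 ^ n)%N.
Proof. by rewrite card_ffun card_bool card_ord. Qed.

Definition flip (j : 'I_n) s : signs := [ffun i => s i (+) (i == j)].

Lemma flipK j : involutive (flip j).
Proof. by move=> s; apply/ffunP => i; rewrite !ffunE -addbA addbb addbF. Qed.

Lemma eps_flip j s i : eps (flip j s) i = (if i == j then -1 else 1) * eps s i.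
Proof.
rewrite ffunE signr_addb mulrC.
by case: (i == j); rewrite ?expr1 ?expr0.
Qed.

Lemma sum_flip_odd j (F : signs -> R) : (forall s, F (flip j s) = - F s) ->
  \sum_(s : signs) F s = 0.
Proof.
move=> Fj; have : \sum_(s : signs) F s = - \sum_(s : signs) F s.
  rewrite -sumrN [LHS](reindex_inj (inv_inj (flipK j))).
  by apply: eq_bigr => s _; rewrite Fj.
by lra.
Qed.

(* Flipping one sign kills every cross term [(i, j)] except [j = i] and
   [j = tau i]. *)
Lemma sign_second_moment (tau : 'I_n -> 'I_n) c : injective tau ->
  (forall i, tau i != i) ->
  \sum_(s : signs) (\sum_i eps s i * eps s (tau i) * c i) ^+ 2 <=
  (2 ^ n)%:R * (2 * \sum_i c i ^+ 2).
Proof.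
move=> tau_inj tau_neq.
pose M i j := \sum_(s : signs) (eps s i * eps s (tau i) * (eps s j * eps s (tau j))).
have M0 i j : j != i -> j != tau i -> M i j = 0.
  (* The flipped sign must belong to an index occurring once among [i], [tau i], [j], [tau j]: this
     is [tau i] if [i = tau j], and [i] otherwise. *)
  move=> ji jti; have [ij|ij] := eqVneq i (tau j).
    apply: (@sum_flip_odd (tau i)) => s; rewrite !eps_flip eqxx.
    rewrite eq_sym (negbTE (tau_neq i)) (negbTE jti) (inj_eq tau_inj) (negbTE ji).
    by ring.
  apply: (@sum_flip_odd i) => s; rewrite !eps_flip eqxx.
  rewrite (negbTE (tau_neq i)) (negbTE ji) eq_sym (negbTE ij).
  by ring.
have Mle i j : `|M i j| <= (2 ^ n)%:R.
  apply: (le_trans (ler_norm_sum _ _ _)).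
  rewrite (eq_bigr (fun=> 1)); last by move=> s _; rewrite !normrM !normr_sign !mulr1.
  by rewrite sumr_const card_signs.
have -> : \sum_(s : signs) (\sum_i eps s i * eps s (tau i) * c i) ^+ 2 =
    \sum_i \sum_j c i * c j * M i j.
  under eq_bigr do rewrite expr2 mulr_suml.
  rewrite exchange_big/=; apply: eq_bigr => i _.
  under eq_bigr do rewrite mulr_sumr.
  rewrite exchange_big/=; apply: eq_bigr => j _.
  by rewrite mulr_sumr; apply: eq_bigr => s _; ring.
(* The term [j = i] gives the first square; the term [j = tau i] is bounded by the mean of two
   squares. Since [tau] permutes the indices, the sum over [i] doubles the sum of squares. *)
have row i : \sum_j c i * c j * M i j <=
    (2 ^ n)%:R * (c i ^+ 2 + (c i ^+ 2 + c (tau i) ^+ 2) / 2).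
  rewrite (bigD1 i)//= (bigD1 (tau i))//= big1 ?addr0; last first.
    by move=> j /andP[ji jti]; rewrite M0// mulr0.
  have := Mle i i; have := Mle i (tau i); rewrite !ler_norml.
  have : 0 <= (2 ^ n)%:R :> R by [].
  move: (M i i) (M i (tau i)) ((2 ^ n)%:R : R) => a b N N0 /andP[b1 b2] /andP[a1 a2].
  rewrite mulrDr lerD//.
    by rewrite -expr2 mulrC ler_wpM2r// sqr_ge0.
  apply: (@le_trans _ _ (`|c i * c (tau i)| * N)).
    apply: (le_trans (ler_norm _)); rewrite normrM ler_wpM2l//.
    by rewrite ler_norml b1.
  rewrite mulrC ler_wpM2l// ler_norml.
  have := sqr_ge0 (c i - c (tau i)); have := sqr_ge0 (c i + c (tau i)).
  by move=> h1 h2; apply/andP; split; nra.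
apply: (le_trans (ler_sum _ (fun i _ => row i))).
rewrite -mulr_sumr ler_wpM2l// big_split/= -mulr_suml big_split/=.
have <- : \sum_i c i ^+ 2 = \sum_i c (tau i) ^+ 2.
  by rewrite [LHS](reindex_inj tau_inj).
by lra.
Qed.

End SignAverages.

(** * Moments of a mean of indicators *)

Section IndicatorMean.
Context (disp : measure_display) (T : measurableType disp) (R : realType).
Variable P : probability T R.

Lemma indic_sum_expectation (J : finType) (A : J -> set T) (c : R) :
  (forall j, measurable (A j)) ->
  ((fun w => c * \sum_j \1_(A j) w) : T -> R) \in Lfun P 1 /\
  ('E_P[fun w => (c * \sum_j \1_(A j) w)%R] = (c * \sum_j pr P (A j))%R%:E)%E.
Proof.
move=> mA; pose S w : R := \sum_j \1_(A j) w.
have iS : P.-integrable setT (EFin \o S).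
  rewrite [F in integrable _ _ F](_ : _ = (fun w => \sum_(j : J) (\1_(A j) w)%:E)%E).
    by apply: integrable_sum => // j _; exact: integrable_indic.
  by apply/funext => w; rewrite /= /S sumEFin.
have LS : S \in Lfun P 1 by exact/Lfun1_integrable.
have ES : ('E_P[S] = (\sum_j pr P (A j))%R%:E)%E.
  rewrite unlock; under eq_integral do rewrite /S -sumEFin.
  rewrite ge0_integral_sum//.
  - rewrite -sumEFin; apply: eq_bigr => j _.
    by rewrite integral_indic// setIT; exact: prE.
  - by move=> j; apply/measurable_EFinP; exact: measurable_indic.
have cS : (fun w => c * S w) = (c \o* S).
  by apply/funext => w; rewrite /= mulrC.
split.
  rewrite cS; apply/Lfun1_integrable.
  rewrite (_ : EFin \o _ = fun w => (c%:E * (EFin \o S) w)%E).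
    exact: integrableZl.
  by apply/funext => w /=; rewrite mulrC EFinM.
by rewrite cS expectationZl// ES.
Qed.

Lemma variance_indic_mean (J : finType) (E : J -> set T) (c : R) :
  (forall j, measurable (E j)) ->
  ('V_P[fun w => (c * \sum_j \1_(E j) w)%R] =
   (c ^+ 2 * (\sum_i \sum_j pr P (E i `&` E j)) -
    (c * \sum_j pr P (E j)) ^+ 2)%R%:E)%E.
Proof.
move=> mE; pose S w : R := c * \sum_j \1_(E j) w.
have [LS ES] := indic_sum_expectation c mE.
have mEE (p : J * J) : measurable (E p.1 `&` E p.2) by exact: measurableI.
have [LSS ESS] := indic_sum_expectation (c ^+ 2) mEE.
have SS : (S * S)%R = (fun w => c ^+ 2 * \sum_(p : J * J) \1_(E p.1 `&` E p.2) w).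
  apply/funext => w; transitivity (S w * S w) => //; rewrite /S mulrACA -(expr2 c); congr (_ * _).
  transitivity (\sum_i \sum_j (\1_(E i) w * \1_(E j) w : R)).
    by rewrite mulr_suml; apply: eq_bigr => i _; rewrite mulr_sumr.
  by rewrite pair_big/=; apply: eq_bigr => -[i j] _; rewrite indicI.
rewrite /variance covarianceE//; last by rewrite -/S SS.
rewrite -/S SS ESS ES -EFinM -EFinB; congr (_ * _ - _)%:E.
by rewrite [RHS]pair_big.
Qed.

End IndicatorMean.

(** * Near independence averaged over the signs *)

Section NearIndependenceAverage.
Context (disp : measure_display) (T : measurableType disp) (R : realType).
Variables (P : probability T R) (n : nat).
Local Notation signs := {ffun 'I_n.+2 -> bool}.

(* With [tau] the shift by [j - i], this turns row [j] into row [i]: see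
   [dotp_signed_row]. *)
Definition twist (tau : 'I_n.+2 -> 'I_n.+2) (s : signs) (x : 'cV[R]_n.+2) :
  'cV[R]_n.+2 := \col_i ((-1) ^+ s i * (-1) ^+ s (tau i) * x (tau i) 0).

Lemma dotp_twist tau s x y : injective tau ->
  dotp (twist tau s x) (twist tau s y) = dotp x y.
Proof.
move=> tau_inj; rewrite [RHS](reindex_inj tau_inj); apply: eq_bigr => i _.
rewrite !mxE mulrACA -expr2 exprMn !sqrr_sign mulr1 mul1r//.
Qed.

(** The right-hand side is the tangent to the square root at [4 * rho ^ 2], the bound for the second
    moment. Being affine in [t], it can be averaged directly, in place of Jensen's inequality. *)
Lemma sqrt_le_amgm (t rho : R) : 0 <= t -> 0 < rho ->
  Num.sqrt t <= t / (4 * rho) + rho.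
Proof.
move=> t0 rho0.
rewrite -{2}(sqr_sqrtr t0); set u := Num.sqrt t.
have := sqr_ge0 (u - 2 * rho) => h.
rewrite -subr_ge0 (_ : _ - u = (u - 2 * rho) ^+ 2 / (4 * rho)).
  by rewrite divr_ge0// mulr_ge0// ltW.
by field; rewrite gt_eqF.
Qed.

Lemma twist_proj_average (tau : 'I_n.+2 -> 'I_n.+2) (x q0 q1 : 'cV[R]_n.+2)
    (rho : R) : injective tau ->
  (forall i, tau i != i) -> 0 < rho -> x != 0 ->
  (forall i, x i 0 ^+ 2 <= rho ^+ 2 * dotp x x) ->
  dotp q0 q0 = 1 -> dotp q1 q1 = 1 ->
  \sum_(s : signs) Num.sqrt ((dotp (twist tau s x) q0 ^+ 2 +
    dotp (twist tau s x) q1 ^+ 2) / dotp (twist tau s x) (twist tau s x)) <=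
  (2 ^ n.+2)%:R * (2 * rho).
Proof.
move=> tau_inj tau_neq rho0 x0 xrho q00 q11.
have xx := dotpp_gt0 x0.
have moment q : dotp q q = 1 -> \sum_(s : signs) dotp (twist tau s x) q ^+ 2 <=
    (2 ^ n.+2)%:R * (2 * (rho ^+ 2 * dotp x x)).
  move=> qq.
  have -> : \sum_(s : signs) dotp (twist tau s x) q ^+ 2 =
      \sum_(s : signs)
        (\sum_i (-1) ^+ s i * (-1) ^+ s (tau i) * (x (tau i) 0 * q i 0)) ^+ 2.
    apply: eq_bigr => s _; congr (_ ^+ 2); apply: eq_bigr => i _.
    by rewrite mxE mulrA.
  (* The coefficients are products of an entry of [x] and one of [q]; bounding the former by [rho]
     times the norm of [x] leaves the squared norm of [q], which is 1. *)
  apply: (le_trans (sign_second_moment _ tau_inj tau_neq)).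
  rewrite ler_wpM2l// ler_wpM2l//.
  rewrite -[leRHS]mulr1 -qq mulr_sumr; apply: ler_sum => i _.
  by rewrite exprMn -expr2 ler_wpM2r ?sqr_ge0.
apply: (@le_trans _ _ (\sum_(s : signs) ((dotp (twist tau s x) q0 ^+ 2 +
    dotp (twist tau s x) q1 ^+ 2) / dotp x x / (4 * rho) + rho))).
  apply: ler_sum => s _; rewrite dotp_twist//; apply: sqrt_le_amgm => //.
  by rewrite divr_ge0 ?dotpp_ge0// addr_ge0// sqr_ge0.
rewrite big_split/= sumr_const card_signs -mulr_suml -mulr_suml big_split/=.
have := moment _ q00; have := moment _ q11.
set A := \sum_(s : signs) _; set B := \sum_(s : signs) _ => hA hB.
rewrite -(mulr_natl rho); set N := (2 ^ n.+2)%:R : R.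
have -> : N * (2 * rho) = N * (4 * (rho ^+ 2 * dotp x x)) / dotp x x / (4 * rho) + N * rho.
  by field; rewrite !gt_eqF.
rewrite lerD2r ler_wpM2r ?invr_ge0 ?mulr_ge0 ?(ltW rho0)//.
rewrite ler_wpM2r ?invr_ge0 ?(ltW xx)//.
rewrite -/N in hA hB; lra.
Qed.

(** The vectors [q0] and [q1] depend on [x] and [y] but not on the signs, so they are fixed before
    averaging. Each of the two roots then averages to at most [2 * rho]. *)
Lemma sdiff_pair_average (tau : 'I_n.+2 -> 'I_n.+2)
    (Z : signs -> T -> 'cV[R]_n.+2) (x y : 'cV[R]_n.+2) (rho : R) :
  injective tau -> (forall i, tau i != i) -> 0 < rho -> x != 0 -> y != 0 ->
  (forall i, x i 0 ^+ 2 <= rho ^+ 2 * dotp x x) ->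
  (forall i, y i 0 ^+ 2 <= rho ^+ 2 * dotp y y) ->
  (forall s, gaussian_vector P (Z s)) ->
  \sum_(s : signs) pr P (sdiff_event (Z s) x y `&`
     sdiff_event (Z s) (twist tau s x) (twist tau s y)) <=
  (2 ^ n.+2)%:R * ((angle x y / pi) ^+ 2 + 16 * rho).
Proof.
move=> tau_inj tau_neq rho0 x0 y0 xrho yrho gZ.
have [q0 [q1 [q00 q11 near_indep]]] := sdiff_event_near_indep P x y.
have twist0 s z : z != 0 -> twist tau s z != 0.
  move=> z0; apply: contraTneq (dotpp_gt0 z0) => tz.
  by rewrite -(dotp_twist s _ _ tau_inj) tz dotp0 ltxx.
have prxy s : pr P (sdiff_event (Z s) x y) = angle x y / pi.
  by rewrite /pr (gaussian_sdiff_angle (gZ s)).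
have prt s : pr P (sdiff_event (Z s) (twist tau s x) (twist tau s y)) = angle x y / pi.
  rewrite /pr (gaussian_sdiff_angle (gZ s)) ?twist0//=.
  by rewrite /angle !l2normE !dotp_twist.
apply: (le_trans (ler_sum _ (fun s _ =>
  near_indep (Z s) _ _ (gZ s) (twist0 s _ x0) (twist0 s _ y0)))).
under eq_bigr do rewrite prxy prt.
rewrite big_split/= sumr_const card_signs -(mulr_natl (_ * _)) -mulr_sumr big_split/= -expr2.
have := twist_proj_average tau_inj tau_neq rho0 x0 xrho q00 q11.
have := twist_proj_average tau_inj tau_neq rho0 y0 yrho q00 q11.
lra.
Qed.

End NearIndependenceAverage.

(** Total mass 1 replaces covering: the sign variables may take other values than 1 and -1 on a null
    set, which the sign patterns miss. *)
Lemma pr_finite_partition (disp : measure_display) (T : measurableType disp)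
    (R : realType) (P : probability T R) (J : finType) (F : J -> set T) (E : set T) :
  (forall j, measurable (F j)) -> trivIset setT F ->
  \sum_j pr P (F j) = 1 -> measurable E ->
  pr P E = \sum_j pr P (E `&` F j).
Proof.
move=> mF tF F1 mE.
have setJ : [set` index_enum J] = setT.
  by apply/seteqP; split=> j //= _; rewrite mem_index_enum.
have addE (G : J -> set T) : (forall j, measurable (G j)) -> trivIset setT G ->
    pr P (\bigcup_j G j) = \sum_j pr P (G j).
  move=> mG tG; apply: EFin_inj; rewrite -prE; last first.
    by apply: fin_bigcup_measurable.
  rewrite measure_fin_bigcup//; last exact: finite_finset.
  transitivity (\sum_(j <- index_enum J) P (G j))%E.
    by rewrite [RHS]fsbig_seq ?index_enum_uniq// setJ.
  by rewrite -sumEFin; apply: eq_bigr => j _; exact: prE.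
have mU : measurable (\bigcup_j F j) by exact: fin_bigcup_measurable.
have mEF j : measurable (E `&` F j) by exact: measurableI.
rewrite -addE//; last exact: trivIset_setIl.
rewrite -setI_bigcupr; apply/eqP; rewrite eq_le; apply/andP; split; last first.
  by apply: pr_le => //; exact: measurableI.
have UC : pr P (~` \bigcup_j F j) = 0.
  rewrite /pr probability_setC// [X in (_ - X)%E]prE// addE// F1.
  by rewrite subee.
rewrite -[leRHS]addr0 -UC.
apply: (le_trans _ (prU_le P (measurableI _ _ mE mU) (measurableC mU))).
apply: pr_le => //.
  by apply: measurableU; [exact: measurableI|exact: measurableC].
by move=> w Ew; have [Uw|Uw] := pselect ((\bigcup_j F j) w); [left|right].
Qed.

(** * Conditioning on the sign pattern *)

Section RandomSigns.
Context (disp : measure_display) (T : measurableType disp) (R : realType).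
Variables (P : probability T R) (n : nat) (r sigma : 'I_n -> {RV P >-> R}).
Hypothesis r_normal : forall i, standard_normal (r i).
Hypothesis sigma_rademacher : forall i, rademacher (sigma i).
Hypothesis indep : mutually_independent (sum_family r sigma).
Local Notation signs := {ffun 'I_n -> bool}.

Let X (i : 'I_n + 'I_n) (w : T) : R := sum_family r sigma i w.

Let mX i : measurable_fun setT (X i).
Proof. by rewrite /X; case: i => i /=; exact: measurable_funPT. Qed.

Let indepX (A : 'I_n + 'I_n -> set R) : (forall i, measurable (A i)) ->
  P (\bigcap_i (X i @^-1` A i)) = (\prod_i P (X i @^-1` A i))%E.
Proof.
move=> mA; have := indep (finset.setT) mA.
rewrite (_ : [set` finset.setT] = setT); last first.
  by apply/seteqP; split=> i //= _; rewrite inE.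
move=> ->; apply: eq_bigl => i; rewrite inE//.
Qed.

Lemma random_vector_gaussian : gaussian_vector P (random_vector r).
Proof.
have rE i : (fun w => random_vector r w i 0) = X (inl i).
  by apply/funext => w; rewrite mxE.
split=> [i|A mA]; first by rewrite rE; exact: mX.
pose B (i : 'I_n + 'I_n) := if i is inl j then A j else setT.
have mB i : measurable (B i) by case: i => i //=; exact: mA.
have := indepX mB; rewrite big_sumType/=.
rewrite [X in (_ * X)%E]big1 ?mule1; last first.
  by move=> i _; rewrite preimage_setT probability_setT.
rewrite (eq_bigr (fun i => normal_prob 0 1 (A i))); last first.
  by move=> i _; exact: (r_normal i (mA i)).
move=> <-; congr (P _); apply/seteqP; split=> w H.
  case=> i _ //=; by have := H i Logic.I; rewrite /= mxE.
by move=> i _; rewrite /= mxE; exact: (H (inl i) Logic.I).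
Qed.

Definition sign_pattern (s : signs) : set T :=
  \bigcap_i (sigma i @^-1` [set (-1) ^+ s i]).

Let B (s : signs) (i : 'I_n + 'I_n) : set R :=
  if i is inr j then [set (-1) ^+ s j] else setT.

Let mB s i : measurable (B s i).
Proof. by case: i => i /=. Qed.

Let patternE s : sign_pattern s = \bigcap_i (X i @^-1` B s i).
Proof.
apply/seteqP; split=> w H; first by case=> i _ //=; exact: H.
by move=> i _; exact: (H (inr i) Logic.I).
Qed.

Lemma measurable_sign_pattern s : measurable (sign_pattern s).
Proof.
by apply: fin_bigcap_measurable.
Qed.

Lemma pr_sign_pattern s : pr P (sign_pattern s) = (2 ^ n)%:R^-1.
Proof.
rewrite /pr patternE indepX// big_sumType/=.
rewrite [X in (X * _)%E]big1 ?mul1e; last first.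
  by move=> i _; rewrite preimage_setT probability_setT.
rewrite (eq_bigr (fun=> (2^-1 : R)%:E)); last first.
  move=> i _; have [s1 s2] := sigma_rademacher i.
  by case: (s i); rewrite /X/= ?expr1 ?expr0.
by rewrite prodEFin/= prodr_const card_ord natrX exprVn.
Qed.

Definition is_inl (i : 'I_n + 'I_n) : bool := if i is inl _ then true else false.

Lemma pr_mix_signs (E : set T) (F : signs -> set T) : measurable E ->
  (forall s, <<s cylinders (fun i w => sum_family r sigma i w : R) is_inl >> (F s)) ->
  (forall s, E `&` sign_pattern s = F s `&` sign_pattern s) ->
  pr P E = (2 ^ n)%:R^-1 * \sum_(s : signs) pr P (F s).
Proof.
move=> mE sF EF.
have N0 : (2 ^ n)%:R != 0 :> R by rewrite pnatr_eq0 expn_eq0.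
rewrite (@pr_finite_partition _ _ _ P _ sign_pattern)//.
- rewrite mulr_sumr; apply: eq_bigr => s _; rewrite EF -(pr_sign_pattern s) mulrC.
  have mF : measurable (F s).
    apply: (smallest_sub _ _ (sF s)); first exact: sigma_algebra_measurable.
    exact: cylinders_measurable.
  have mS := measurable_sign_pattern s.
  apply: EFin_inj; rewrite EFinM -!prE//; last exact: measurableI.
  apply: (@block_indep _ _ _ P _ X mX indepX is_inl) => //.
  apply: sub_sigma_algebra; exists (B s); split => //.
  by case=> i.
- by move=> s; exact: measurable_sign_pattern.
- move=> s s' _ _ [w [H H']]; apply/ffunP => i.
  have := H i Logic.I; have := H' i Logic.I => /= -> /eqP.
  by rewrite -subr_eq0; case: (s i); case: (s' i) => //=;
    rewrite ?expr1 ?expr0 ?opprK// => /eqP; lra.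
- rewrite (eq_bigr (fun=> (2 ^ n)%:R^-1)); last by move=> s _; exact: pr_sign_pattern.
  by rewrite sumr_const card_signs -(mulr_natl _^-1) divff.
Qed.

End RandomSigns.

(** * The rows of the circulant matrix *)

Lemma ord_mod_subE (n : nat) (i j : 'I_n.+1) : ord_mod_sub i j = i - j.
Proof. by apply: val_inj; rewrite /= modnDmr. Qed.

Lemma ord_mod_sub_inj (n : nat) (i : 'I_n.+1) : injective (ord_mod_sub i).
Proof.
by move=> j j'; rewrite !ord_mod_subE => /addrI/oppr_inj.
Qed.

Lemma linfnorm_ratio (R : realType) (n : nat) (x : 'cV[R]_n) (rho : R) :
  x != 0 -> linfnorm x / l2norm x <= rho ->
  0 < rho /\ forall i, x i 0 ^+ 2 <= rho ^+ 2 * dotp x x.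
Proof.
move=> x0 xrho; have xx := dotpp_gt0 x0.
have nx : 0 < l2norm x by rewrite l2normE sqrtr_gt0.
have linf i : `|x i 0| <= linfnorm x.
  by rewrite /linfnorm; exact: (le_bigmax _ (fun i => `|x i 0|)).
have linf0 : 0 <= linfnorm x by rewrite /linfnorm; exact: bigmax_ge_id.
have rho0 : 0 <= rho by rewrite (le_trans _ xrho)// divr_ge0// ltW.
have sq i : x i 0 ^+ 2 <= rho ^+ 2 * dotp x x.
  have -> : dotp x x = l2norm x ^+ 2 by rewrite l2normE sqr_sqrtr// ltW.
  rewrite -exprMn -real_normK ?num_real// ler_pXn2r ?nnegrE ?mulr_ge0// ?(ltW nx)//.
  by rewrite (le_trans (linf i))// -ler_pdivrMr.
split => //; rewrite lt_def rho0 andbT; apply: contraTneq xx => rho_eq0.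
rewrite -leNgt; apply: sumr_le0 => i _.
by have := sq i; rewrite rho_eq0 expr0n mul0r -expr2.
Qed.

Lemma norm_sign_diff (R : realType) (a b : R) :
  `|sign a - sign b| = 2 * (sdiff a b)%:R.
Proof.
rewrite /sign /sdiff; case: (0 <= a); case: (0 <= b) => /=.
- by rewrite subrr normr0 mulr0.
- by rewrite opprK mulr1 ger0_norm ?addr_ge0.
- by rewrite -opprD normrN mulr1 ger0_norm ?addr_ge0.
- by rewrite subrr normr0 mulr0.
Qed.

Section CirculantEmbeddingLaw.
Context (disp : measure_display) (T : measurableType disp) (R : realType).
Variables (P : probability T R) (n : nat) (r sigma : 'I_n.+2 -> {RV P >-> R}).
Hypothesis r_normal : forall i, standard_normal (r i).
Hypothesis sigma_rademacher : forall i, rademacher (sigma i).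
Hypothesis indep : mutually_independent (sum_family r sigma).
Local Notation signs := {ffun 'I_n.+2 -> bool}.
Implicit Types (i j : 'I_n.+2) (x y z : 'cV[R]_n.+2) (s : signs).

Definition circ_form z i (w : T) : R :=
  \sum_j r (ord_mod_sub i j) w * sigma j w * z j 0.

Definition circ_event x y i : set T :=
  [set w | sdiff (circ_form x i w) (circ_form y i w)].

(** The signs are frozen to [s], so that the Gaussian variables alone remain random. *)
Definition signed_row i s (w : T) : 'cV[R]_n.+2 :=
  \col_m ((-1) ^+ s m * random_vector r w (ord_mod_sub i m) 0).

Lemma signed_row_gaussian i s : gaussian_vector P (signed_row i s).
Proof.
apply: gaussian_signed_perm; first exact: ord_mod_sub_inj.
exact: (random_vector_gaussian r_normal indep).
Qed.

Lemma measurable_circ_event x y i : measurable (circ_event x y i).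
Proof.
have mform z : measurable_fun setT (circ_form z i).
  rewrite [F in measurable_fun _ F](_ : _ = (fun w =>
      \sum_j z j 0 * (r (ord_mod_sub i j) w * sigma j w))).
    apply: measurable_lincomb => j _.
    by apply: measurable_funM; exact: measurable_funPT.
  by apply/funext => w; apply: eq_bigr => j _; rewrite mulrC.
exact: measurable_sdiff.
Qed.

Lemma circ_event_pattern x y i s :
  circ_event x y i `&` sign_pattern sigma s =
  sdiff_event (signed_row i s) x y `&` sign_pattern sigma s.
Proof.
have formE z w : sign_pattern sigma s w ->
    circ_form z i w = dotp (signed_row i s w) z.
  move=> sw; apply: eq_bigr => j _; rewrite !mxE.
  by rewrite (sw j Logic.I : sigma j w = _) [X in X * _]mulrC.
apply/seteqP; split=> w [H sw]; split=> //; move: H;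
  by rewrite /circ_event /sdiff_event /= !formE.
Qed.

Lemma signed_row_sigma x y i s :
  <<s cylinders (fun k w => sum_family r sigma k w : R) (@is_inl _) >>
    (sdiff_event (signed_row i s) x y).
Proof.
apply: (@measurable_sdiff _ _ (g_sigma_algebraType (cylinders
  (fun k w => sum_family r sigma k w : R) (@is_inl _)))).
  rewrite [F in measurable_fun _ F](_ : _ = (fun w =>
      \sum_m ((-1) ^+ s m * x m 0) * sum_family r sigma (inl (ord_mod_sub i m)) w)).
    by apply: measurable_lincomb => m _; exact: measurable_coordinate.
  by apply/funext => w; apply: eq_bigr => m _; rewrite !mxE mulrAC.
rewrite [F in measurable_fun _ F](_ : _ = (fun w =>
    \sum_m ((-1) ^+ s m * y m 0) * sum_family r sigma (inl (ord_mod_sub i m)) w)).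
  by apply: measurable_lincomb => m _; exact: measurable_coordinate.
by apply/funext => w; apply: eq_bigr => m _; rewrite !mxE mulrAC.
Qed.

Lemma pr_circ_event x y i : x != 0 -> y != 0 ->
  pr P (circ_event x y i) = angle x y / pi.
Proof.
move=> x0 y0.
rewrite (pr_mix_signs sigma_rademacher indep (measurable_circ_event x y i)
  (signed_row_sigma x y i) (circ_event_pattern x y i)).
rewrite (eq_bigr (fun=> angle x y / pi)); last first.
  by move=> s _; rewrite /pr (gaussian_sdiff_angle (signed_row_gaussian i s)).
rewrite sumr_const card_signs -(mulr_natl (_ / _)) mulKf//.
Qed.

(** At position [m + (j - i)], row [j] holds the same Gaussian variable as row [i] at position [m].
    The sign at [m], inserted twice, completes the signed entry of row [i]. *)
Lemma dotp_signed_row i j s w z :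
  dotp (signed_row j s w) z =
  dotp (signed_row i s w) (twist (fun m => m + (j - i)) s z).
Proof.
rewrite /dotp (reindex_inj (addIr (j - i))); apply: eq_bigr => m _.
rewrite !mxE !ord_mod_subE (_ : j - (m + (j - i)) = i - m); last first.
  by rewrite opprD opprB addrCA subrKC addrC.
by have := sqrr_sign R (s m); rewrite expr2 => ss; ring: ss.
Qed.

Lemma pr_circ_event_pair x y i j rho : i != j -> x != 0 -> y != 0 -> 0 < rho ->
  (forall m, x m 0 ^+ 2 <= rho ^+ 2 * dotp x x) ->
  (forall m, y m 0 ^+ 2 <= rho ^+ 2 * dotp y y) ->
  pr P (circ_event x y i `&` circ_event x y j) <=
  (angle x y / pi) ^+ 2 + 16 * rho.
Proof.
move=> ij x0 y0 rho0 xrho yrho.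
have mE := measurableI _ _ (measurable_circ_event x y i) (measurable_circ_event x y j).
pose F s := sdiff_event (signed_row i s) x y `&` sdiff_event (signed_row j s) x y.
rewrite (pr_mix_signs (F := F) sigma_rademacher indep mE).
- rewrite ler_pdivrMl ?ltr0n ?expn_gt0//.
  have tau_neq m : m + (j - i) != m.
    by rewrite -subr_eq0 addrAC subrr add0r subr_eq0 eq_sym.
  have := @sdiff_pair_average _ _ _ P n _ (signed_row i) x y rho (addIr (j - i))
    tau_neq rho0 x0 y0 xrho yrho (signed_row_gaussian i).
  congr (_ <= _); apply: eq_bigr => s _; congr (pr P (_ `&` _)); apply/seteqP.
  by split=> w; rewrite /sdiff_event/= -!dotp_signed_row.
- move=> s; apply: (@measurableI _ (g_sigma_algebraType (cylinders
    (fun k w => sum_family r sigma k w : R) (@is_inl _)))); exact: signed_row_sigma.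
- have splitI (A B C : set T) : A `&` B `&` C = (A `&` C) `&` (B `&` C).
    by rewrite setIACA setIid.
  by move=> s; rewrite splitI !circ_event_pattern -splitI.
Qed.

End CirculantEmbeddingLaw.

(** * Variance of the normalised Hamming distance *)

Theorem theorem3 (R : realType) (disp : measure_display)
  (T : measurableType disp) (P : probability T R)
  (d k : nat) (d_ge2 : (2 <= d)%N) (k_ge1 : (1 <= k)%N) (le_kd : (k <= d)%N)
  (r sigma : 'I_d -> {RV P >-> R})
  (r_normal : forall i, standard_normal (r i))
  (sigma_rademacher : forall i, rademacher (sigma i))
  (indep : mutually_independent (sum_family r sigma))
  (x y : 'cV[R]_d) (x_neq0 : x != 0) (y_neq0 : y != 0)
  (rho : R) (rho_lt1 : rho < 1)
  (xy_rho : Num.max (linfnorm x / l2norm x) (linfnorm y / l2norm y) <= rho) :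
  let theta := angle x y in
  let Phi (z : 'cV[R]_d) (w : T) :=
    circ_embedding le_kd (random_vector r w) (random_vector sigma w) z in
  let dist (w : T) : R := 1 / (2 * k%:R) * l1norm (Phi x w - Phi y w) in
  ('V_P[dist] <=
     (1 / k%:R * (theta / pi) * (1 - theta / pi) + 32 * rho)%R%:E)%E.
Proof.
case: d d_ge2 le_kd r sigma r_normal sigma_rademacher indep x y x_neq0 y_neq0 xy_rho
  => [|[|n]]// _ le_kd r sigma r_normal sigma_rademacher indep x y x0 y0.
move=> xy_rho; pose theta := angle x y.
pose Phi (z : 'cV[R]_n.+2) (w : T) :=
  circ_embedding le_kd (random_vector r w) (random_vector sigma w) z.
pose dist (w : T) : R := 1 / (2 * k%:R) * l1norm (Phi x w - Phi y w).
change ('V_P[dist] <=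
  (1 / k%:R * (theta / pi) * (1 - theta / pi) + 32 * rho)%R%:E)%E.
move: xy_rho; rewrite ge_max => /andP[xr yr].
have [rho0 xrho] := linfnorm_ratio x0 xr; have [_ yrho] := linfnorm_ratio y0 yr.
pose E (i : 'I_k) := circ_event r sigma x y (widen_ord le_kd i).
have mE i : measurable (E i) by exact: measurable_circ_event.
have k0 : k%:R != 0 :> R by rewrite pnatr_eq0 -lt0n.
have kgt0 : 0 < k%:R :> R by rewrite ltr0n.
have PhiE z w i : Phi z w i 0 = sign (circ_form r sigma z (widen_ord le_kd i) w).
  rewrite /Phi /circ_embedding mxE; congr sign.
  rewrite mul_mx_diag mxE; apply: eq_bigr => j _.
  by rewrite !mxE.
(* Two different bits are at distance 2, which cancels the 2 of the normalisation. *)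
have -> : dist = (fun w => k%:R^-1 * \sum_i \1_(E i) w).
  apply/funext => w; rewrite /dist /l1norm.
  rewrite (eq_bigr (fun i => 2 * \1_(E i) w)); last first.
    move=> i _.
    have -> : (Phi x w - Phi y w) i 0 = Phi x w i 0 - Phi y w i 0 by rewrite !mxE.
    rewrite !PhiE norm_sign_diff.
    by rewrite indicE mem_setE.
  by rewrite -mulr_sumr; field.
rewrite variance_indic_mean// lee_fin.
set p := theta / pi.
have prE i : pr P (E i) = p by exact: pr_circ_event.
(* The diagonal term is [p]; the [k - 1] others are counted as [k] minus one, in the reals, to avoid
   truncated subtraction. *)
have pair i : \sum_j pr P (E i `&` E j) <= p + k%:R * (p ^+ 2 + 16 * rho) - (p ^+ 2 + 16 * rho).
  have -> : k%:R * (p ^+ 2 + 16 * rho) = \sum_(j < k) (p ^+ 2 + 16 * rho).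
    by rewrite sumr_const card_ord mulr_natl.
  rewrite (bigD1 i)//= setIid prE [in leRHS](bigD1 i)//=.
  rewrite -addrA lerD2l addrAC subrr add0r; apply: ler_sum => j ji.
  apply: pr_circ_event_pair => //.
  by apply: contra ji => /eqP/(congr1 val)/= ij; apply/eqP/val_inj.
have tot : \sum_i \sum_j pr P (E i `&` E j) <=
    k%:R * (p + k%:R * (p ^+ 2 + 16 * rho) - (p ^+ 2 + 16 * rho)).
  apply: (le_trans (ler_sum _ (fun i _ => pair i))).
  by rewrite sumr_const card_ord -(mulr_natl (_ - _)).
rewrite [in X in _ - X](eq_bigr (fun=> p))// sumr_const card_ord -(mulr_natl p) mulKf//.
apply: (@le_trans _ _ (k%:R^-1 ^+ 2 *
  (k%:R * (p + k%:R * (p ^+ 2 + 16 * rho) - (p ^+ 2 + 16 * rho))) - p ^+ 2)).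
  by rewrite lerD2r ler_wpM2l// exprn_ge0// invr_ge0 ltW.
(* The off-diagonal pairs contribute [16 * rho * (1 - 1 / k)] to the error, which is below
   [32 * rho]. *)
have -> : k%:R^-1 ^+ 2 *
  (k%:R * (p + k%:R * (p ^+ 2 + 16 * rho) - (p ^+ 2 + 16 * rho))) - p ^+ 2 =
  1 / k%:R * p * (1 - p) + 16 * rho - 16 * rho / k%:R by field.
have : 0 <= 16 * rho / k%:R by rewrite divr_ge0 ?mulr_ge0 ?(ltW rho0) ?(ltW kgt0).
lra.
Qed.
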